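(* Let $n\ge 1$, let $x_1,\dots,x_n\in\mathbb{R}$ be distinct, let $w_1,\dots,w_n\in\mathbb{R}$ and $v_1,\dots,v_n\ge 0$, and let $M$ be the Pick matrix of the corresponding Problem $\partial NP\mathcal{P}$. Then: (i) Problem $\partial NP\mathcal{P}$ is solvable if and only if $M$ is positive definite or minimally positive. (ii) The solution set of the problem, if non-empty, contains a real rational function of degree no greater than the rank of $M$. (iii) The problem is determinate if and only if $M$ is minimally positive.
   Context: $\Pi=\{z\in\mathbb{C}:\operatorname{Im} z>0\}$. The Pick class $\mathcal{P}$ is the set of functions analytic and with non-negative imaginary part in $\Pi$. A function $f\in\mathcal{P}$ is analytic at $x\in\mathbb{R}$ if it extends analytically to a neighbourhood of $x$ in $\mathbb{C}$; $f(x)$ and $f'(x)$ are then the values of the extension and its derivative. Problem $\partial NP\mathcal{P}$ with data $x_j,w_j,v_j$ ($1\le j\le n$): determine whether there is $f\in\mathcal{P}$, analytic at $x_1,\dots,x_n$, with $f(x_j)=w_j$ and $f'(x_j)=v_j$ for $j=1,\dots,n$. Any such $f$ is called a solution. The problem is solvable if it has at least one solution, and determinate if it has exactly one solution. The Pick matrix of the problem is the $n\times n$ matrix $M=[m_{ij}]$ with $m_{ii}=v_i$ and $m_{ij}=\dfrac{w_i-w_j}{x_i-x_j}$ for $i\ne j$. A positive semidefinite matrix is minimally positive if it majorises no non-zero positive semidefinite diagonal matrix ($M$ majorises $D$ if $M-D$ is positive semidefinite). A real rational function is a rational function with real coefficients. *)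

(* Defs.v *)
From HB Require Import structures.
From mathcomp Require Export all_boot all_order all_algebra.
From mathcomp Require Export all_classical all_reals all_analysis.
From mathcomp Require Export complex.

Set Implicit Arguments.
Unset Strict Implicit.
Unset Printing Implicit Defensive.

Export Order.TTheory GRing.Theory Num.Theory.
Export numFieldNormedType.Exports.

Local Open Scope classical_set_scope.
Local Open Scope ring_scope.
Local Open Scope complex_scope.

(* The complex field over R, with its structure fixed to numClosedFieldType so
   that it inherits the canonical topology and norm of a numFieldType. *)
Definition C (R : realType) : numClosedFieldType := R[i].

Section PickClass.
Variable R : realType.

Definition Pi : set (C R) := [set z | 0 < complex.Im z].

Definition analytic_at (f : C R -> C R) (c : C R) : Prop :=
  exists a : nat -> C R,
    \forall z \near c, series (fun k => a k * (z - c) ^+ k) @ \oo --> f z.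

(* Functions on the half-plane are total functions on the complex field whose
   values outside Pi are irrelevant. *)
Definition pick_class (f : C R -> C R) : Prop :=
  forall z, Pi z -> analytic_at f z /\ 0 <= complex.Im (f z).

(* F is an analytic extension of f (a function on Pi) to a neighbourhood of
   the real point x; only the values of F on that neighbourhood matter. *)
Definition analytic_extension_at (f : C R -> C R) (x : R)
    (F : C R -> C R) : Prop :=
  exists U : set (C R), [/\ open U, U x%:C,
    forall z, U z -> analytic_at F z
    & forall z, U z -> Pi z -> F z = f z].

Definition real_poly_eval (p : {poly R}) (z : C R) : C R :=
  (map_poly (real_complex R) p).[z].

(* On Pi, f is a quotient of two real polynomials in lowest terms whose larger
   degree is d. *)
Definition real_rational_of_degree (f : C R -> C R) (d : nat) : Prop :=
  exists p q : {poly R}, [/\ coprimep p q,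
    d = maxn (size p).-1 (size q).-1
    & forall z, Pi z -> real_poly_eval q z != 0 /\
        f z = real_poly_eval p z / real_poly_eval q z].

End PickClass.

Section Positivity.
Variables (R : realType) (n : nat).
Implicit Types A D : 'M[R]_n.

Definition pos_semidef A : Prop :=
  A^T = A /\ forall u : 'cV[R]_n, 0 <= (u^T *m A *m u) 0 0.

Definition pos_def A : Prop :=
  A^T = A /\ forall u : 'cV[R]_n, u != 0 -> 0 < (u^T *m A *m u) 0 0.

Definition majorises A D : Prop := pos_semidef (A - D).

Definition minimally_positive A : Prop :=
  pos_semidef A /\
  forall D, is_diag_mx D -> pos_semidef D -> majorises A D -> D = 0.

End Positivity.

Section BoundaryNevanlinnaPick.
Variables (R : realType) (n : nat) (x w v : 'I_n -> R).

Definition pick_matrix : 'M[R]_n :=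
  \matrix_(i, j) if i == j then v i else (w i - w j) / (x i - x j).

Definition solution (f : C R -> C R) : Prop :=
  pick_class f /\
  forall j, exists F : C R -> C R,
    [/\ analytic_extension_at f (x j) F,
        F (x j)%:C = (w j)%:C
      & is_derive ((x j)%:C : C R) 1 F (v j)%:C].

Definition solvable_problem : Prop := exists f, solution f.

(* Solutions are functions on Pi, hence identified when they agree there. *)
Definition determinate : Prop :=
  exists2 f, solution f &
    forall g, solution g -> forall z, Pi z -> g z = f z.

End BoundaryNevanlinnaPick.

(* Main.v *)
(* Necessity.  The Schur algorithm (split off one interior point at a time with
   the Schwarz lemma of the half-plane) shows that for f in the Pick class the
   kernel (f z - conj f z') / (z - conj z') is positive semidefinite.  Letting all
   but one of the points tend to x_1, ..., x_n gives M >= 0, and moreover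
   sum_j u_j (f z - w_j) / (z - x_j) = 0 on Pi whenever M u = 0.  So if M is
   singular then f is the quotient of sum_j u_j w_j / (z - x_j) by
   sum_j u_j / (z - x_j).

   Sufficiency.  Conversely, for a null vector u of minimal support this quotient
   lies in the Pick class, because its imaginary part is Im z times the value of
   M at the complex vector (u_j / (z - x_j))_j, divided by |denominator|^2.  It
   interpolates at the nodes of the support of u, and at any other node x_i up to
   a "defect" in the derivative; the defect vanishes when M is minimally positive
   and also when a solution exists.  A positive definite M is reduced to the
   singular case by adding one node t with a value om, the derivative there being
   chosen to make the larger Pick matrix singular; two choices of om give two
   solutions. *)
Require Import Defs.
From mathcomp Require Import ring lra.
Set Implicit Arguments.
Unset Strict Implicit.
Unset Printing Implicit Defensive.
Import Normc.
Local Open Scope classical_set_scope.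
Local Open Scope ring_scope.
Local Open Scope complex_scope.

(** * Null vectors of positive semidefinite forms *)

Section Forms.
Variables (R : realType) (n : nat).
Implicit Types (A : 'M[R]_n) (u y z : 'cV[R]_n).

(** The defect measures a shortfall. At a node x_i off the support of u the quotient has derivative
    v_i + defect / beta, where -beta * defect >= 0 is the value of M at the vector [shifted i]. So
    for semidefinite M the quotient always solves the relaxed problem f'(x_i) <= v_i, and the
    shortfall -defect / beta is exactly the i-th diagonal entry that Cauchy-Schwarz allows M to
    majorise. This is what ties solvability to minimal positivity.

    Minimality of the support controls the denominator. A zero of it, in Pi or at a node off the
    support, would yield another null vector inside the support, hence a multiple of u; that
    confines the support to a single node, where a zero is impossible. Minimality also limits the
    support to rank + 1 points, which bounds the degree.

    Analyticity means local power series, and all that is extracted from it is continuity, the order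
    of a zero and the maximum principle. In the other direction the solutions built are rational, so
    only quotients of polynomials have to be expanded. *)

Definition bform A u y : R := (u^T *m A *m y) 0 0.

Lemma bformE A u y : bform A u y = \sum_i u i 0 * (A *m y) i 0.
Proof. by rewrite /bform -mulmxA mxE; apply: eq_bigr => i _; rewrite mxE. Qed.

Lemma bform_sumE A u y : bform A u y = \sum_i \sum_j u i 0 * y j 0 * A i j.
Proof.
rewrite bformE; apply: eq_bigr => i _; rewrite mxE mulr_sumr.
by apply: eq_bigr => j _; ring.
Qed.

Lemma bformDl A u y z : bform A (u + y) z = bform A u z + bform A y z.
Proof. by rewrite /bform linearD /= !mulmxDl mxE. Qed.

Lemma bformDr A u y z : bform A z (u + y) = bform A z u + bform A z y.
Proof. by rewrite /bform mulmxDr mxE. Qed.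

Lemma bformZl A (t : R) u z : bform A (t *: u) z = t * bform A u z.
Proof. by rewrite /bform linearZ /= -!scalemxAl mxE. Qed.

Lemma bformZr A (t : R) u z : bform A z (t *: u) = t * bform A z u.
Proof. by rewrite /bform -scalemxAr mxE. Qed.

Lemma bformC A u y : A^T = A -> bform A u y = bform A y u.
Proof.
move=> sA; rewrite /bform -[in RHS]sA -[in LHS](trmxK (_ *m y)) mxE.
by rewrite !trmx_mul trmxK mulmxA.
Qed.

Lemma bform_cauchy_schwarz A u y : pos_semidef A ->
  bform A u y ^+ 2 <= bform A u u * bform A y y.
Proof.
move=> [sA pA].
have h t : 0 <= bform A u u + 2 * t * bform A u y + t ^+ 2 * bform A y y.
  have := pA (u + t *: y); rewrite -/(bform _ _ _).
  rewrite bformDl !bformDr !bformZl !bformZr (bformC y u sA).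
  by move=> h; apply: le_trans h _; rewrite le_eqVlt; apply/orP; left; apply/eqP; ring.
have U0 : 0 <= bform A u u by exact: pA.
have Y0 : 0 <= bform A y y by exact: pA.
move: (bform A u u) (bform A u y) (bform A y y) U0 Y0 h => U B Y U0 Y0 h.
have [Y00|Y1] := eqVneq Y 0; last first.
  have Yp : 0 < Y by rewrite lt_def Y1.
  have := h (- B / Y).
  have -> : U + 2 * (- B / Y) * B + (- B / Y) ^+ 2 * Y = U - B ^+ 2 / Y by field.
  by rewrite subr_ge0 ler_pdivrMr.
subst Y; rewrite mulr0; have [->|B0] := eqVneq B 0; first by rewrite expr0n.
(* With Y = 0 the quadratic is affine in t with slope 2 B; this t gives it the value -1. *)
have := h (- (U + 1) / (2 * B)).
have -> : U + 2 * (- (U + 1) / (2 * B)) * B + (- (U + 1) / (2 * B)) ^+ 2 * 0 = -1.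
  by field.
by rewrite ler0N1.
Qed.

Lemma psd_null A u : pos_semidef A -> bform A u u = 0 -> A *m u = 0.
Proof.
move=> pA u0; apply/matrixP => i k; rewrite [k]ord1 [RHS]mxE.
have := bform_cauchy_schwarz (delta_mx i 0) u pA.
rewrite u0 mulr0 bformE (bigD1 i)//= big1 ?addr0.
  rewrite mxE !eqxx mul1r => h; apply/eqP; rewrite -sqrf_eq0 eq_le h.
  by rewrite sqr_ge0.
by move=> j ji; rewrite mxE (negPf ji) mul0r.
Qed.

Lemma psd_singular A : pos_semidef A -> ~ pos_def A ->
  exists2 u : 'cV[R]_n, u != 0 & A *m u = 0.
Proof.
move=> pA npA; apply: contrapT => h; apply: npA; split; first exact: pA.1.
move=> u u0; rewrite lt_def pA.2 andbT; apply/eqP => Au.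
by apply: h; exists u => //; exact: psd_null.
Qed.

Definition support_set u : {set 'I_n} := [set i | u i 0 != 0]%SET.

(* The support of u is minimal among nonzero null vectors. *)
Definition minimal_null A u : Prop := [/\ u != 0, A *m u = 0 &
  forall y, A *m y = 0 -> (forall i, u i 0 = 0 -> y i 0 = 0) ->
  exists t, y = t *: u].

Lemma cV_neq0 u : u != 0 -> exists i, u i 0 != 0.
Proof.
move=> u0; apply: contrapT => h; move/negP: u0; apply; apply/eqP/matrixP => i k.
rewrite [k]ord1 [RHS]mxE; apply/eqP/negPn/negP => ui; apply: h.
by exists i.
Qed.

(** Descent on the size of the support: a null vector inside the support of u and not proportional
    to u, corrected by a multiple of u so as to vanish at one point of that support, has a smaller
    one. *)
Lemma exists_minimal_null A u : u != 0 -> A *m u = 0 ->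
  exists y, minimal_null A y.
Proof.
have [k] := ubnP #|support_set u|; elim: k u => // k ih u.
rewrite ltnS => uk u0 Au.
have [h|] := pselect (minimal_null A u); first by exists u.
move=> nmin.
have [z [Az zu z0 [i [ui zi]]]] : exists z : 'cV[R]_n, [/\ A *m z = 0,
    forall i, u i 0 = 0 -> z i 0 = 0, z != 0 & exists i, u i 0 != 0 /\ z i 0 = 0].
  apply: contrapT => h; apply: nmin; split=> // y Ay yu.
  have [i ui] := cV_neq0 u0.
  exists (y i 0 / u i 0); apply/eqP/negPn/negP => neq; apply: h.
  exists (y - (y i 0 / u i 0) *: u); split.
  - by rewrite mulmxBr -scalemxAr Au Ay scaler0 subr0.
  - by move=> j uj; rewrite !mxE uj (yu j uj) mulr0 subr0.
  - by rewrite subr_eq0.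
  - by exists i; rewrite !mxE divfK// subrr.
apply: (ih z) => //; apply: leq_trans uk; apply: proper_card.
apply/properP; split.
  apply/fintype.subsetP => j; rewrite !inE; apply: contraNneq => uj.
  by rewrite zu.
exists i; first by rewrite inE.
by apply/negP; rewrite inE zi eqxx.
Qed.

(** Cauchy-Schwarz against y reads (t z_i)^2 <= <z, z> <y, y>, so A majorises [d] = t^2 / <y, y>
    times the i-th diagonal unit. *)
Lemma not_minimally_positive A y i (t : R) : pos_semidef A ->
  A *m y = t *: delta_mx i 0 -> t != 0 -> 0 < bform A y y ->
  ~ minimally_positive A.
Proof.
move=> pA Ay t0 y0 [_ minA].
have zAy z : bform A z y = z i 0 * t.
  rewrite bformE Ay (bigD1 i)//= big1 ?addr0; first by rewrite !mxE !eqxx mulr1.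
  by move=> j /negPf ji; rewrite !mxE ji !mulr0.
pose d := t ^+ 2 / bform A y y.
have d0 : 0 < d by rewrite divr_gt0// exprn_even_gt0.
have dE z : bform (d *: delta_mx i i) z z = d * z i 0 ^+ 2.
  rewrite bform_sumE (bigD1 i)//= (bigD1 i)//= !big1 ?addr0.
  - by rewrite !mxE !eqxx /=; ring.
  - by move=> j /negPf ji; rewrite big1// => k _; rewrite !mxE ji /= !mulr0.
  - by move=> j /negPf ji; rewrite !mxE ji andbF !mulr0.
have : d *: delta_mx i i = 0 :> 'M[R]_n.
  apply: minA.
  - apply/is_diag_mxP => j k jk; rewrite !mxE.
    case: (j =P i) => [ji|_]; last by rewrite mulr0.
    case: (k =P i) => [ki|_]; last by rewrite mulr0.
    by rewrite ji ki eqxx in jk.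
  - split; first by rewrite linearZ /= trmx_delta.
    by move=> z; rewrite -/(bform _ _ _) dE mulr_ge0 ?sqr_ge0// ltW.
  - split; first by rewrite linearB linearZ /= trmx_delta pA.1.
    move=> z; rewrite -/(bform _ _ _).
    have -> : bform (A - d *: delta_mx i i) z z = bform A z z - bform (d *: delta_mx i i) z z.
      by rewrite /bform mulmxBr mulmxBl !mxE.
    rewrite subr_ge0 dE /d mulrAC ler_pdivrMr// -exprMn mulrC.
    by have := bform_cauchy_schwarz z y pA; rewrite zAy.
move=> /matrixP/(_ i i); rewrite !mxE !eqxx mulr1 => d00.
by rewrite d00 ltxx in d0.
Qed.

Lemma pos_def_semidef A : pos_def A -> pos_semidef A.
Proof.
move=> [sA pA]; split=> // u; have [->|u0] := eqVneq u 0; last exact/ltW/pA.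
by rewrite mulmx0 mxE.
Qed.

Lemma pos_def_row_free A : pos_def A -> row_free A.
Proof.
move=> [sA pA]; apply: inj_row_free => a aA.
apply/eqP/negPn/negP => a0; have := pA a^T.
rewrite trmxK aA mul0mx mxE ltxx => h; suff : false by [].
by apply: h; apply: contraNneq a0 => h; rewrite -[a]trmxK h trmx0.
Qed.

(** The index [i] rules out n = 0, where the empty matrix is both positive definite and minimally
    positive. *)
Lemma pos_def_not_minimally_positive A (i : 'I_n) : pos_def A ->
  ~ minimally_positive A.
Proof.
move=> pA; have uA : A \in unitmx by rewrite -row_free_unit pos_def_row_free.
apply: (@not_minimally_positive A (invmx A *m delta_mx i 0) i 1).
- exact: pos_def_semidef.
- by rewrite mulKVmx// scale1r.
- exact: oner_neq0.
apply: pA.2; apply/eqP => h.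
have := congr1 (mulmx A) h; rewrite mulKVmx// mulmx0 => /matrixP/(_ i 0).
by rewrite !mxE !eqxx => /eqP; rewrite oner_eq0.
Qed.
End Forms.

(** * Null vectors of Pick matrices *)

Section PickMatrix.
Variables (R : realType) (n : nat) (x w v : 'I_n -> R).
Hypothesis x_inj : injective x.
Notation M := (pick_matrix x w v).

Lemma pick_matrix_sym : M^T = M.
Proof.
apply/matrixP => i j; rewrite !mxE eq_sym; case: eqP => [->//|_].
by rewrite -mulrNN -invrN !opprB.
Qed.

Lemma pick_matrixM i j : M i j * (x i - x j) = w i - w j.
Proof.
rewrite mxE; case: eqP => [->|/eqP ij]; first by rewrite !subrr mulr0.
by rewrite divfK// subr_eq0 (inj_eq x_inj).
Qed.

Variable u : 'cV[R]_n.
Hypothesis Mu : minimal_null M u.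

(* [shifted i] solves (x_i - X) y = u with X = diag(x) and coordinates of sum 0.
   The displacement identity X M - M X = w e^T - e w^T shows that M sends it to a
   multiple of the i-th basis vector, and [defect i] is that multiple; the junk
   value 1 / 0 = 0 is harmless since [u i 0 = 0] whenever these are used. *)
Definition beta i : R := \sum_j u j 0 / (x i - x j).
Definition defect i : R := \sum_j u j 0 * M i j / (x i - x j) - beta i * v i.
Definition shifted i : 'cV[R]_n :=
  \col_j (u j 0 / (x i - x j)) - beta i *: delta_mx i 0.

Lemma null_sum i : \sum_j M i j * u j 0 = 0.
Proof. by case: Mu => _ /matrixP/(_ i 0) + _; rewrite !mxE. Qed.

Lemma shiftedE i j : shifted i j 0 =
  u j 0 / (x i - x j) - beta i * (j == i)%:R.
Proof. by rewrite !mxE eqxx andbT. Qed.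

Lemma shifted_diag i : shifted i i 0 = - beta i.
Proof. by rewrite shiftedE subrr invr0 mulr0 eqxx mulr1 sub0r. Qed.

Lemma mulmx_shifted_diag i : (M *m shifted i) i 0 = defect i.
Proof.
rewrite mxE /defect.
have -> : \sum_j M i j * shifted i j 0 =
   \sum_j (u j 0 * M i j / (x i - x j) - M i j * (beta i * (j == i)%:R)).
  by apply: eq_bigr => j _; rewrite shiftedE; ring.
rewrite sumrB; congr (_ - _); rewrite (bigD1 i)//= big1 ?addr0.
  by rewrite eqxx mulr1 mxE eqxx mulrC.
by move=> j /negPf ->; rewrite mulr0 mulr0.
Qed.

Lemma mulmx_shifted_off i j : u i 0 = 0 -> j != i -> (M *m shifted i) j 0 = 0.
Proof.
move=> ui ji; set y := shifted i.
have yu k : (x i - x k) * y k 0 = u k 0.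
  rewrite shiftedE; have [->|ki] := eqVneq k i; first by rewrite subrr mul0r ui.
  by rewrite mulr0 subr0 mulrC divfK// subr_eq0 (inj_eq x_inj) eq_sym.
have y0 : \sum_k y k 0 = 0.
  under eq_bigr do rewrite shiftedE.
  rewrite sumrB -/(beta i) -mulr_sumr (bigD1 i)//= big1 ?eqxx ?addr0 ?mulr1 ?subrr//.
  by move=> k /negPf ->.
(* By the displacement identity (x_i - x_k) (M y)_k does not depend on k; at k = i it is 0. *)
have key k : (x i - x k) * (M *m y) k 0 = \sum_l w l * y l 0.
  rewrite mxE mulr_sumr.
  have -> : \sum_l (x i - x k) * (M k l * y l 0) =
     \sum_l (M k l * u l 0 - w k * y l 0 + w l * y l 0).
    apply: eq_bigr => l _; rewrite -yu.
    have -> : w l = w k - M k l * (x k - x l) by rewrite pick_matrixM; ring.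
    ring.
  by rewrite big_split /= sumrB null_sum -mulr_sumr y0 mulr0 subrr add0r.
apply/eqP; have := key j; rewrite -(key i) subrr mul0r => /eqP.
by rewrite mulf_eq0 subr_eq0 (inj_eq x_inj) eq_sym (negPf ji).
Qed.

Lemma shifted_null i : u i 0 = 0 -> defect i = 0 -> M *m shifted i = 0.
Proof.
move=> ui di; apply/matrixP => j k; rewrite [k]ord1 [RHS]mxE.
have [->|ji] := eqVneq j i; first by rewrite mulmx_shifted_diag.
exact: mulmx_shifted_off.
Qed.

Lemma bform_shifted z i : u i 0 = 0 -> bform M z (shifted i) = z i 0 * defect i.
Proof.
move=> ui; rewrite bformE (bigD1 i)//= mulmx_shifted_diag big1 ?addr0//.
by move=> j ji; rewrite mulmx_shifted_off// mulr0.
Qed.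

(** The form at [shifted i] is -beta * defect, so beta = 0 would make that vector null, with support
    inside that of u, hence a multiple of u. Then 1 / (x_i - x_j) is constant on the support, which
    is thus a single node, and beta is one nonzero term. *)
Lemma beta_neq0 i : pos_semidef M -> u i 0 = 0 -> beta i != 0.
Proof.
move=> pM ui; apply/eqP => b0.
have My : M *m shifted i = 0.
  by apply: psd_null => //; rewrite bform_shifted// shifted_diag b0 oppr0 mul0r.
case: Mu => u0 _ /(_ _ My)[|t yt].
  by move=> j uj; rewrite shiftedE uj b0 !mul0r subrr.
have [j uj] := cV_neq0 u0.
have ti k : u k 0 != 0 -> (x i - x k)^-1 = t.
  move=> uk; move/matrixP: yt => /(_ k 0); rewrite shiftedE b0 mul0r subr0 mxE.
  by rewrite mulrC => /(mulIf uk).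
have xij : x i - x j != 0.
  rewrite subr_eq0 (inj_eq x_inj); apply: contraNneq uj => <-.
  by rewrite ui.
move/eqP: b0; rewrite /beta (bigD1 j)//= big1 ?addr0.
  by rewrite mulf_eq0 (negPf uj) invr_eq0 (negPf xij).
move=> k kj; have [->|uk] := eqVneq (u k 0) 0; first by rewrite mul0r.
have : (x i - x k)^-1 = (x i - x j)^-1 by rewrite !ti.
move=> /invr_inj /addrI /oppr_inj /x_inj kj'.
by rewrite kj' eqxx in kj.
Qed.

(** M maps [shifted i] to the defect times e_i, and its form -beta * defect is positive once the
    defect is nonzero, so [not_minimally_positive] applies. *)
Lemma minimally_positive_defect i : minimally_positive M -> u i 0 = 0 ->
  defect i = 0.
Proof.
move=> [pM minM] ui; apply/eqP/negPn/negP => d0.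
have b0 := beta_neq0 pM ui.
apply: (@not_minimally_positive _ _ M (shifted i) i (defect i)) => //.
  apply/matrixP => j k; rewrite (ord1 k) [RHS]mxE.
  have [->|ji] := eqVneq j i; first by rewrite mulmx_shifted_diag mxE !eqxx mulr1.
  by rewrite mulmx_shifted_off// mxE (negPf ji) mulr0.
rewrite lt_def pM.2 andbT bform_shifted// shifted_diag.
by rewrite mulf_neq0// oppr_eq0.
Qed.

(** For D diagonal with 0 <= D <= M, D_ii = 0 as soon as some null vector of M has a nonzero i-th
    coordinate. Such a vector is u on its support and, off it, [shifted i], whose i-th coordinate is
    -beta. *)
Lemma defect_minimally_positive : pos_semidef M ->
  (forall i, u i 0 = 0 -> defect i = 0) -> minimally_positive M.
Proof.
move=> pM dM; split=> // D Ddiag pD maj.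
have nullD (z : 'cV[R]_n) i : M *m z = 0 -> z i 0 != 0 -> D i i = 0.
  move=> Mz zi.
  have := maj.2 z; rewrite mulmxBr mulmxBl -mulmxA Mz mulmx0 sub0r mxE oppr_ge0.
  have Dn j : 0 <= D j j.
    have := pD.2 (delta_mx j 0).
    rewrite trmx_delta -rowE -colE !mxE. by [].
  rewrite -/(bform _ _ _) bform_sumE.
  have -> : \sum_a \sum_b z a 0 * z b 0 * D a b = \sum_a z a 0 ^+ 2 * D a a.
    apply: eq_bigr => a _; rewrite (bigD1 a)//= big1 ?addr0 ?expr2//.
    by move=> b ba; move/is_diag_mxP: Ddiag => ->; rewrite ?mulr0// eq_sym.
  move=> h; have : z i 0 ^+ 2 * D i i <= 0.
    apply: le_trans h; rewrite (bigD1 i)//= lerDl sumr_ge0// => j _.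
    by rewrite mulr_ge0// sqr_ge0.
  rewrite pmulr_rle0 ?exprn_even_gt0//= => Di.
  by apply/eqP; rewrite eq_le Di Dn.
apply/matrixP => i j; rewrite [RHS]mxE; have [<-|ij] := eqVneq i j; last first.
  by move/is_diag_mxP: Ddiag => ->.
have [ui|ui] := eqVneq (u i 0) 0.
  apply: (nullD (shifted i)); first by apply: shifted_null => //; exact: dM.
  by rewrite shifted_diag oppr_eq0 beta_neq0.
by apply: (nullD u) => //; case: Mu.
Qed.

(** The rows of M indexed by the support without one point [i0] are free: by symmetry of M a
    relation among them is a null vector inside the support that vanishes at [i0], hence the zero
    multiple of u. *)
Lemma minimal_null_rank : (#|support_set u| <= (\rank M).+1)%N.
Proof.
have [u0 _ _] := Mu; have [i0 ui0] := cV_neq0 u0.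
set K := support_set u.
have iK : i0 \in K by rewrite inE.
rewrite (cardsD1 i0) iK add1n ltnS.
pose N := rowsub (enum_val : 'I_#|(K :\ i0)%SET| -> 'I_n) M.
have : row_free N.
  apply: inj_row_free => a aN.
  pose z : 'cV[R]_n := \col_i \sum_(k | enum_val k == i) a 0 k.
  have zE k : z (enum_val k) 0 = a 0 k.
    by rewrite mxE (big_pred1 k)// => l; rewrite (inj_eq enum_val_inj).
  have z0 i : i \notin (K :\ i0)%SET -> z i 0 = 0.
    move=> iK'; rewrite mxE big_pred0// => k; apply: contraNF iK' => /eqP <-.
    exact: enum_valP.
  have Mz : M *m z = 0.
    apply/matrixP => i k; rewrite [k]ord1 [RHS]mxE.
    move/matrixP: aN => /(_ 0 i); rewrite !mxE => aN; rewrite -[RHS]aN.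
    rewrite (bigID (mem ((K :\ i0)%SET)))/= [X in _ + X]big1 ?addr0; last first.
      by move=> j /z0 ->; rewrite mulr0.
    rewrite big_enum_val; apply: eq_bigr => l _.
    rewrite zE mulrC; congr (_ * _).
    by rewrite -[in LHS]pick_matrix_sym !mxE.
  case: Mu => _ _ /(_ z Mz)[|t zt].
    move=> i ui; apply: z0; rewrite !inE ui eqxx andbF//.
  have t0 : t = 0.
    have := z0 i0; rewrite !inE eqxx => /(_ isT).
    by rewrite zt mxE => /eqP; rewrite mulf_eq0 (negPf ui0) orbF => /eqP.
  by apply/matrixP => i k; rewrite (ord1 i) -zE zt t0 scale0r !mxE.
rewrite -row_leq_rank => h; apply: leq_trans h _.
by apply: mxrankS; exact: rowsub_sub.
Qed.
End PickMatrix.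

(** * Power series and the maximum modulus principle *)

Section Topology.
Variable R : realType.
Notation C := (C R).
Implicit Types (z c : C) (f g : C -> C).

Lemma norm_normc z : `|z| = (normc z)%:C :> C.
Proof. by []. Qed.

(** The norm of [C] takes values in [C] itself; real radii and the real-valued [normc] open the
    estimates to real arithmetic. *)
Lemma near_normcP (P : C -> Prop) c :
  (\forall z \near c, P z) <->
  exists2 e : R, 0 < e & forall z, normc (z - c) < e -> P z.
Proof.
split.
  case/nbhs_ballP => e /=; rewrite ltcE /= => /andP[/eqP e0 e1] h.
  exists (complex.Re e) => // z zc; apply: h.
  by rewrite -ball_normE /= distrC norm_normc ltcE /= zc e0 eqxx.
case=> e e0 h; apply/nbhs_ballP; exists (e%:C).
  by rewrite /= ltcR.
move=> z; rewrite -ball_normE /= distrC norm_normc ltcR; exact: h.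
Qed.

Lemma cvg_normcP (f : C -> C) c (l : C) :
  f z @[z --> c] --> l <->
  forall e : R, 0 < e -> \forall z \near c, normc (f z - l) < e.
Proof.
split.
  move=> /cvgrPdist_lt h e e0.
  have e0' : 0 < e%:C :> C by rewrite ltcR.
  near=> z; rewrite -ltcR -norm_normc distrC.
  by near: z; exact: h.
move=> h; apply/(@cvgrPdist_lt _ _ _ (nbhs c) _ f l) => e; rewrite ltcE /= => /andP[/eqP e0 e1].
near=> z; rewrite distrC norm_normc ltcE /= e0 eqxx /=.
by near: z; exact: h.
Unshelve. all: end_near. Qed.

Lemma continuous_real (f : C -> R) :
  (forall z c, `|f z - f c| <= normc (z - c)) -> continuous f.
Proof.
move=> h c; apply/(@cvgrPdist_lt _ _ _ (nbhs c) _ f (f c)) => e e0.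
apply/near_normcP; exists e => // z.
by apply: le_lt_trans; rewrite distrC.
Qed.

Lemma normc_ge0 (z : C) : 0 <= normc z.
Proof. by rewrite -lecR -norm_normc normr_ge0. Qed.

Lemma normc_Re (z : C) : `|complex.Re z| <= normc z.
Proof. by have := normc_ge_Re z; rewrite norm_normc lecR. Qed.

Lemma normc_Im (z : C) : `|complex.Im z| <= normc z.
Proof.
case: z => a b /=; rewrite -(sqrtr_sqr b).
by rewrite ler_sqrt ?addr_ge0 ?sqr_ge0// lerDr sqr_ge0.
Qed.

Lemma Im_continuous : continuous (@complex.Im R : C -> R).
Proof.
apply: continuous_real => z c.
have -> : complex.Im z - complex.Im c = complex.Im (z - c) by case: z c => ? ? [].
exact: normc_Im.
Qed.

Lemma normc_dist (z c : C) : `|normc z - normc c| <= normc (z - c).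
Proof.
have h1 : normc z <= normc (z - c) + normc c.
  by apply: le_trans (le_normcD _ _); rewrite subrK.
have h2 : normc c <= normc (z - c) + normc z.
  rewrite -(normcN (z - c)).
  by apply: le_trans (le_normcD _ _); rewrite opprB subrK.
rewrite ler_norml; lra.
Qed.

Lemma normc_continuous : continuous (@normc R : C -> R).
Proof. exact: continuous_real normc_dist. Qed.

Definition complex_of_pair (u : R * R) : C := (u.1 +i* u.2).

Lemma complex_of_pair_continuous : continuous complex_of_pair.
Proof.
move=> [a b]; apply/(@cvgrPdist_lt _ _ _ (nbhs (a, b)) _ complex_of_pair) => e.
rewrite ltcE /= => /andP[/eqP e0 e1].
have h u : normc (complex_of_pair u - (a +i* b)) <= `|u.1 - a| + `|u.2 - b|.
  case: u => u v /=.
  rewrite -[leRHS]ger0_norm ?addr_ge0// -(sqrtr_sqr (_ + _)).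
  rewrite ler_sqrt ?sqr_ge0// [leRHS]sqrrD.
  by rewrite !real_normK ?num_real// lerD2r lerDl mulrn_wge0// mulr_ge0.
near=> u.
rewrite distrC norm_normc ltcE /= e0 eqxx /=; apply: le_lt_trans (h u) _.
rewrite [ltRHS]splitr; apply: ltrD; near: u.
  apply: (@cvgr_distC_lt _ _ _ (nbhs (a, b)) _ fst a); last exact: divr_gt0.
  exact: cvg_fst.
apply: (@cvgr_distC_lt _ _ _ (nbhs (a, b)) _ snd b); last exact: divr_gt0.
exact: cvg_snd.
Unshelve. all: end_near. Qed.
End Topology.

Section PowerSeries.
Variable R : realType.
Notation C := (C R).
Implicit Types (z c : C) (f g : C -> C) (a b : nat -> C).

Lemma cvgn_normcP (u : nat -> C) (l : C) :
  u @ \oo --> l <->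
  forall e : R, 0 < e -> \forall n \near \oo, normc (u n - l) < e.
Proof.
split.
  move=> /cvgrPdist_lt h e e0.
  have e0' : 0 < e%:C :> C by rewrite ltcR.
  near=> z; rewrite -ltcR -norm_normc distrC.
  by near: z; exact: h.
move=> h; apply/cvgrPdist_lt => e; rewrite ltcE /= => /andP[/eqP e0 e1].
near=> z; rewrite distrC norm_normc ltcE /= e0 eqxx /=.
by near: z; exact: h.
Unshelve. all: end_near. Qed.

Lemma normc_eq0 (z : C) : (normc z == 0) = (z == 0).
Proof. by rewrite -(inj_eq (@complexI R)) -norm_normc normr_eq0. Qed.

Lemma normc_gt0 (z : C) : (0 < normc z) = (z != 0).
Proof. by rewrite lt_def normc_eq0 normc_ge0 andbT. Qed.

Lemma normcX (z : C) n : normc (z ^+ n) = normc z ^+ n.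
Proof. by elim: n => [|n ih]; rewrite ?expr0 ?normc1// !exprS normcM ih. Qed.

Definition power_series_at a f c : Prop :=
  \forall z \near c, series (fun k => a k * (z - c) ^+ k) @ \oo --> f z.

Lemma series_center a c : series (fun k => a k * (c - c) ^+ k) @ \oo --> a 0%N.
Proof.
apply/cvgn_normcP => e e0; near=> n.
rewrite /series /=; have n0 : (0 < n)%N by near: n; exact: nbhs_infty_gt.
rewrite big_ltn// big_nat big1 ?addr0.
  by rewrite expr0 mulr1 subrr normc0.
by move=> [|i]//= _; rewrite subrr expr0n mulr0.
Unshelve. all: end_near. Qed.

Lemma power_series_center a f c : power_series_at a f c -> f c = a 0%N.
Proof.
move=> /nbhs_singleton h; rewrite -(cvg_lim _ h); last exact: norm_hausdorff.
by apply: cvg_lim; [exact: norm_hausdorff|exact: series_center].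
Qed.

(** Convergence at the single point c + [h0] bounds |a_k| h0^k by some [B]; on the disc of radius h0
    / 2 a geometric series then dominates f z - f c. *)
Lemma power_series_bound a f c : power_series_at a f c ->
  exists r B : R, [/\ 0 < r, 0 < B &
    forall z, normc (z - c) < r -> normc (f z - f c) <= B * normc (z - c)].
Proof.
move=> h; have fc := power_series_center h.
move/near_normcP : h => [e e0 h].
pose h0 : R := e / 2; have h00 : 0 < h0 by rewrite divr_gt0.
have : cvgn (series (fun k => a k * (c + h0%:C - c) ^+ k)).
  apply/cvg_ex; exists (f (c + h0%:C)); apply: h.
  rewrite [c + _]addrC addrK /= expr0n addr0 sqrtr_sqr ger0_norm ?ltW//.
  by rewrite /h0; lra.
move=> /cvg_series_cvg_0 /cvgn_normcP /(_ 1 ltr01)[N _ hN].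
have [B B0 hB] : exists2 B : R, 0 < B & forall k, normc (a k) * h0 ^+ k <= B.
  have nE k : normc (a k) * h0 ^+ k = normc (a k * (c + h0%:C - c) ^+ k).
    rewrite [c + _]addrC addrK normcM normcX /= expr0n addr0 sqrtr_sqr.
    by rewrite ger0_norm ?ltW.
  exists (1 + \sum_(k < N) normc (a k) * h0 ^+ k).
    rewrite ltr_wpDr// sumr_ge0// => i _.
    by rewrite mulr_ge0 ?normc_ge0// exprn_ge0 ?ltW.
  move=> k; have [kN|Nk] := ltnP k N.
    rewrite (bigD1 (Ordinal kN))//= addrCA lerDl addr_ge0// sumr_ge0// => i _.
    by rewrite mulr_ge0 ?normc_ge0// exprn_ge0 ?ltW.
  apply: (@le_trans _ _ 1).
    by have := hN k Nk; rewrite /= subr0 -nE => /ltW.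
  rewrite lerDl sumr_ge0// => i _.
  by rewrite mulr_ge0 ?normc_ge0// exprn_ge0 ?ltW.
exists (h0 / 2), (B / h0 * 2); split; [exact: divr_gt0|by rewrite mulr_gt0// divr_gt0|].
move=> z zc.
set q := normc (z - c) / h0.
have q0 : 0 <= q by rewrite divr_ge0 ?normc_ge0 ?ltW.
have q2 : q <= 2^-1 by rewrite ler_pdivrMr// mulrC; apply/ltW.
(* The last factor is the sum of 2^-k over k < n, in closed form for the induction. *)
have bnd n : normc (series (fun k => a k * (z - c) ^+ k) n.+1 - a 0%N)
    <= B * q * (2 - 2 * 2^-1 ^+ n).
  elim: n => [|n ih].
    by rewrite /series /= big_nat1 expr0 !mulr1 subrr normc0 subrr mulr0.
  rewrite seriesSr addrAC; apply: le_trans (le_normcD _ _) _.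
  have : normc (a n.+1 * (z - c) ^+ n.+1) <= B * q * 2^-1 ^+ n.
    have -> : normc (a n.+1 * (z - c) ^+ n.+1) =
        (normc (a n.+1) * h0 ^+ n.+1) * q ^+ n.+1.
      rewrite normcM normcX -mulrA -exprMn /q mulrCA divff ?mulr1//.
      exact: lt0r_neq0.
    rewrite -[leRHS]mulrA; apply: ler_pM => //.
    - by rewrite mulr_ge0 ?normc_ge0// exprn_ge0 ?ltW.
    - exact: exprn_ge0.
    - by rewrite exprS ler_wpM2l// lerXn2r// ?nnegrE// invr_ge0.
  move=> h1; apply: le_trans (lerD ih h1) _.
  by rewrite exprS -!mulrDr; rewrite le_eqVlt; apply/orP; left; apply/eqP; field.
have S : series (fun k => a k * (z - c) ^+ k) @ \oo --> f z.
  by apply: h; apply: lt_trans zc _; rewrite /h0; lra.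
rewrite fc; apply/ler_addgt0Pr => d d0.
move/cvgn_normcP : S => /(_ d d0)[M _ hM].
have := hM M.+1 (leqnSn M).
rewrite /= => hM1.
have -> : f z - a 0%N = - (series (fun k => a k * (z - c) ^+ k) M.+1 - f z) +
   (series (fun k => a k * (z - c) ^+ k) M.+1 - a 0%N) by ring.
apply: le_trans (le_normcD _ _) _; rewrite normcN addrC lerD//; last exact: ltW.
apply: le_trans (bnd M) _.
rewrite /q [leRHS](_ : _ = B * (normc (z - c) / h0) * 2); last by field; exact: lt0r_neq0.
apply: ler_wpM2l; first by rewrite mulr_ge0// ltW.
by rewrite lerBlDr lerDl mulr_ge0// exprn_ge0// invr_ge0.
Qed.

Lemma analytic_continuous f c : analytic_at f c -> f z @[z --> c] --> f c.
Proof.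
case=> a /power_series_bound[r [B [r0 B0 h]]].
apply/cvg_normcP => e e0; apply/near_normcP.
exists (Num.min r (e / B)).
  by rewrite lt_min r0 divr_gt0.
move=> z; rewrite lt_min => /andP[zr ze]; apply: le_lt_trans (h _ zr) _.
by rewrite mulrC -ltr_pdivlMr.
Qed.

Lemma power_series_tail a f c : power_series_at a f c ->
  exists2 g, power_series_at (fun k => a k.+1) g c &
    \forall z \near c, f z = f c + (z - c) * g z.
Proof.
move=> h; have fc := power_series_center h.
exists (fun z => if z == c then a 1%N else (f z - f c) / (z - c)); last first.
  apply/near_normcP; exists 1 => // z _; case: eqP => [->|/eqP zc].
    by rewrite subrr mul0r addr0.
  by rewrite mulrC divfK ?subr_eq0// addrC subrK.
rewrite /power_series_at; near=> z.
case: ifPn => [/eqP ->|zc]; first exact: (@series_center (fun k => a k.+1) c).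
have zc0 : z - c != 0 by rewrite subr_eq0.
have -> : series (fun k => a k.+1 * (z - c) ^+ k) =
   (fun n => (series (fun k => a k * (z - c) ^+ k) n.+1 - f c) * (z - c)^-1).
  apply/funext => n; rewrite /series /= big_nat_recl//= expr0 mulr1 fc.
  rewrite addrAC subrr add0r mulr_suml; apply: eq_bigr => i _.
  by rewrite exprSr mulrA mulfK.
apply: cvgM; last exact: cvg_cst.
apply: cvgB; last exact: cvg_cst.
have : series (fun k => a k * (z - c) ^+ k) @ \oo --> f z by near: z.
by rewrite -(cvg_shiftS (series _)).
Unshelve. all: end_near. Qed.
End PowerSeries.

Section Analytic.
Variable R : realType.
Notation C := (C R).
Implicit Types (z c : C) (f g : C -> C) (a b : nat -> C).

Lemma power_series_factor a f c k : power_series_at a f c ->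
  (forall j, (j < k)%N -> a j = 0) ->
  exists2 g, power_series_at (fun i => a (k + i)%N) g c &
    \forall z \near c, f z = (z - c) ^+ k * g z.
Proof.
move=> h; elim: k => [|k ih] ak.
  by exists f => //; near=> z; rewrite expr0 mul1r.
have [|g hg fg] := ih; first by move=> j jk; apply: ak; exact: ltnW.
have g0 : g c = 0 by rewrite (power_series_center hg) addn0 ak.
have [g' hg' gg'] := power_series_tail hg.
exists g'.
  by under eq_fun do rewrite addSnnS.
near=> z; rewrite exprSr -mulrA.
have -> : (z - c) * g' z = g z.
  by rewrite -[LHS]add0r -g0; apply/esym; near: z.
by near: z.
Unshelve. all: end_near. Qed.

(** Here k + 1 is the index of the first nonzero coefficient after the constant one, and g c is that
    coefficient. *)
Lemma analytic_local f c : analytic_at f c ->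
  (\forall z \near c, f z = f c) \/
  exists k g, [/\ g c != 0, g z @[z --> c] --> g c &
    \forall z \near c, f z = f c + (z - c) ^+ k.+1 * g z].
Proof.
case=> a h; have fc := power_series_center h.
have [ex|a0] := pselect (exists i, a i.+1 != 0).
  right; case: (ex_minnP ex) => k ak kmin.
  have [g hg fg] := power_series_tail h.
  have [|G hG gG] := @power_series_factor (fun i => a i.+1) g c k hg.
    move=> j jk; apply/eqP/negPn/negP => aj.
    by have := kmin _ aj; rewrite leqNgt jk.
  exists k, G; split.
  - by rewrite (power_series_center hG) addn0.
  - by apply: analytic_continuous; exists (fun i => a (k + i).+1).
  - near=> z; rewrite exprS -mulrA.
    have <- : g z = (z - c) ^+ k * G z by near: z.
    by near: z.
left; near=> z.
have S : series (fun k => a k * (z - c) ^+ k) @ \oo --> f z by near: z; exact: h.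
rewrite fc -(cvg_lim _ S); last exact: norm_hausdorff.
apply: cvg_lim; first exact: norm_hausdorff.
have aE : (fun k => a k * (z - c) ^+ k) = (fun k => a k * (c - c) ^+ k).
  apply/funext => -[|i]; first by rewrite !expr0.
  by have [->|ai] := eqVneq (a i.+1) 0; [rewrite !mul0r|case: a0; exists i].
by rewrite aE; exact: series_center.
Unshelve. all: end_near. Qed.

Lemma analytic_cst (k : C) c : analytic_at (fun=> k) c.
Proof.
exists (fun i => if i == 0%N then k else 0); near=> z.
apply/cvgn_normcP => e e0; near=> n.
rewrite /series /=; have n0 : (0 < n)%N by near: n; exact: nbhs_infty_gt.
rewrite big_ltn// big_nat big1 ?addr0.
  by rewrite expr0 mulr1 subrr normc0.
by move=> [|i]//= _; rewrite mul0r.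
Unshelve. all: end_near. Qed.

Lemma analyticD f g c : analytic_at f c -> analytic_at g c ->
  analytic_at (fun z => f z + g z) c.
Proof.
move=> [a /near_normcP[d d0 ha]] [b /near_normcP[e e0 hb]].
exists (fun k => a k + b k); apply/near_normcP; exists (Num.min d e).
  by rewrite lt_min d0.
move=> z; rewrite lt_min => /andP[zd ze].
have -> : series (fun k => (a k + b k) * (z - c) ^+ k) =
   (fun n => series (fun k => a k * (z - c) ^+ k) n +
             series (fun k => b k * (z - c) ^+ k) n).
  apply/funext => n; rewrite /series /= -big_split; apply: eq_bigr => i _.
  by rewrite mulrDl.
exact: (cvgD (ha z zd) (hb z ze)).
Qed.

Lemma analyticZ (k : C) f c : analytic_at f c ->
  analytic_at (fun z => k * f z) c.
Proof.
move=> [a /near_normcP[d d0 ha]].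
exists (fun i => k * a i); apply/near_normcP; exists d; [exact: d0|move=> z zd].
rewrite [series _](_ : _ =
   (fun n => k * series (fun k => a k * (z - c) ^+ k) n)); last first.
  apply/funext => n; rewrite /series /= mulr_sumr; apply: eq_bigr => i _.
  by rewrite mulrA.
exact: (cvgM (cvg_cst _) (ha z zd)).
Qed.

Lemma analyticM_center f c : analytic_at f c ->
  analytic_at (fun z => (z - c) * f z) c.
Proof.
move=> [a /near_normcP[d d0 ha]].
exists (fun i => if i is j.+1 then a j else 0).
apply/near_normcP; exists d; [exact: d0|move=> z zd].
rewrite -(cvg_shiftS (series _)) /=.
rewrite (_ : (fun n => series _ n.+1) =
   (fun n => (z - c) * series (fun k => a k * (z - c) ^+ k) n)); last first.
  apply/funext => n; rewrite /series /= big_nat_recl// mul0r add0r mulr_sumr.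
  by apply: eq_bigr => i _; rewrite exprS mulrCA.
exact: (cvgM (cvg_cst _) (ha z zd)).
Qed.

Lemma analyticB f g c : analytic_at f c -> analytic_at g c ->
  analytic_at (fun z => f z - g z) c.
Proof.
move=> hf hg; have := analyticD hf (analyticZ (-1) hg).
by under eq_fun do rewrite mulN1r.
Qed.

Lemma analyticM_linear (l : C) f c : analytic_at f c ->
  analytic_at (fun z => (z - l) * f z) c.
Proof.
move=> hf; have := analyticD (analyticM_center hf) (analyticZ (c - l) hf).
by under eq_fun do rewrite -mulrDl addrA subrK.
Qed.

End Analytic.

Section MaxModulus.
Variable R : realType.
Notation C := (C R).
Implicit Types (z c : C) (f g p q : C -> C).

(* Quotients of analytic germs suffice for the maximum principle and are stable
   under Moebius maps, so no product or inverse of power series is needed. *)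
Definition ratio_at g c : Prop := exists p q,
  [/\ analytic_at p c, analytic_at q c, q c != 0 &
      \forall z \near c, g z = p z / q z].

Lemma near_and (P Q : C -> Prop) c :
  (\forall z \near c, P z) -> (\forall z \near c, Q z) ->
  \forall z \near c, P z /\ Q z.
Proof. exact: filterI. Qed.

Lemma near_neq0 f c : f z @[z --> c] --> f c -> f c != 0 ->
  \forall z \near c, f z != 0.
Proof.
move=> /cvg_normcP h fc; have /h : 0 < normc (f c) by rewrite normc_gt0.
move=> /near_normcP[e e0 he]; apply/near_normcP; exists e => // z /he.
by apply: contraTN => /eqP ->; rewrite sub0r normcN ltxx.
Qed.

Lemma ratio_continuous g c : ratio_at g c -> g z @[z --> c] --> g c.
Proof.
move=> [p [q [/analytic_continuous hp /analytic_continuous hq qc0 hg]]].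
have /cvg_normcP h : p z / q z @[z --> c] --> p c / q c.
  exact: (cvgM hp (cvgV qc0 hq)).
apply/cvg_normcP => e /h he; have gc := nbhs_singleton hg.
have /near_normcP[d d0 hd] := near_and hg he.
by apply/near_normcP; exists d => // z /hd[]; rewrite gc => ->.
Qed.

(** If g is not constant near c, then g z = g c + (z - c)^(k+1) G z / q z with [m] = G c / q c
    nonzero. In a direction where (z - c)^(k+1) m is a positive multiple of g c the modulus grows,
    against the maximum. *)
Lemma local_maximum g c : ratio_at g c ->
  (\forall z \near c, normc (g z) <= normc (g c)) ->
  \forall z \near c, g z = g c.
Proof.
move=> [p [q [hp hq qc0 hg]]] gmax.
have gc := nbhs_singleton hg.
have hqc := analytic_continuous hq.
have q0 := near_neq0 hqc qc0.
have [l0|l0] := eqVneq (g c) 0.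
  move: gmax => /near_normcP[e e0 h]; apply/near_normcP; exists e => // z /h.
  rewrite l0 normc0 => hz; apply/eqP; rewrite -normc_eq0.
  by rewrite eq_le hz normc_ge0.
have hh := analyticB hp (analyticZ (g c) hq).
have hc : p c - g c * q c = 0 by rewrite gc divfK// subrr.
have [hE|[k [G [Gc0 hG hE]]]] := analytic_local hh.
  have /near_normcP[e e0 h] := near_and hE (near_and hg q0).
  apply/near_normcP; exists e => // z /h[/eqP + [-> qz0]].
  by rewrite hc subr_eq0 => /eqP ->; rewrite mulfK.
exfalso.
set m := G c / q c; have m0 : m != 0 by rewrite mulf_neq0 ?invr_eq0.
have /cvg_normcP hH : G z / q z @[z --> c] --> m.
  exact: (cvgM hG (cvgV qc0 hqc)).
have /hH hm : 0 < normc m / 2 by rewrite divr_gt0// normc_gt0.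
have /near_normcP[d d0 h] :=
  near_and hm (near_and hE (near_and hg (near_and q0 gmax))).
(* This is the direction of growth: moving by t * eta multiplies g c by 1 + t^(k+1), up to an error
   smaller than half the gain. *)
pose eta := k.+1.-root (g c / m) : C.
have etaE : eta ^+ k.+1 * m = g c by rewrite rootCK// divfK.
have eta0 : 0 < normc eta.
  rewrite normc_gt0; apply/eqP => e0; move: etaE.
  by rewrite e0 expr0n/= mul0r => /esym/eqP; rewrite (negPf l0).
pose t : R := d / 2 / normc eta.
have t0 : 0 < t by rewrite !divr_gt0.
have tE : normc (t%:C) = t by rewrite /= expr0n addr0 sqrtr_sqr gtr0_norm.
have := h (c + t%:C * eta).
rewrite [c + _]addrC addrK normcM tE /t divfK; last exact: lt0r_neq0.
rewrite -/t; have d2 : d / 2 < d by lra.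
move=> /(_ d2)[]; set z := _ + c; move=> hz [hzE [gz [qz0]]]; apply/negP.
rewrite -ltNge.
set T := t ^+ k.+1; have T0 : 0 < T by rewrite exprn_gt0.
have -> : g z = g c * (1 + T)%:C + T%:C * eta ^+ k.+1 * (G z / q z - m).
  have -> : T%:C = t%:C ^+ k.+1 :> C by rewrite rmorphXn.
  rewrite rmorphD /= rmorphXn /= gz.
  have -> : p z = g c * q z + (t%:C * eta) ^+ k.+1 * G z.
    move: hzE; rewrite /= hc add0r => <-.
    by rewrite addrC subrK.
  rewrite exprMn -[in g c * (1 + _)]etaE.
  have -> : g c = eta ^+ k.+1 * m by [].
  by rewrite ?rmorph1; field.
have sub (a b : C) : normc a - normc b <= normc (a + b).
  rewrite lerBlDr -(normcN b); apply: le_trans (le_normcD _ _).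
  by rewrite addrK.
apply: lt_le_trans (sub _ _).
rewrite !normcM normcX.
have nR (r : R) : 0 <= r -> normc (r%:C) = r.
  by move=> r0; rewrite /= expr0n addr0 sqrtr_sqr ger0_norm.
rewrite !nR ?addr_ge0 ?ltW//.
have gE : normc (g c) = normc eta ^+ k.+1 * normc m.
  by rewrite -etaE normcM normcX.
rewrite gE.
set E := normc eta ^+ k.+1; have E0 : 0 < E by rewrite exprn_gt0.
move: hz; set D := normc (_ - m) => hz.
have m1 : 0 < normc m by rewrite normc_gt0.
have : T * E * D < T * E * (normc m / 2) by rewrite ltr_pM2l// mulr_gt0.
have : 0 < T * E * normc m by rewrite !mulr_gt0.
rewrite mulrDr mulr1; have -> : E * normc m * T = T * E * normc m by ring.
have -> : T * E * (normc m / 2) = (T * E * normc m) / 2 by ring.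
lra.
Qed.
End MaxModulus.

(** * Schwarz lemma of the half-plane *)

Section Schwarz.
Variable R : realType.
Notation C := (C R).
Implicit Types (z c : C) (f g p q s : C -> C).

Lemma sqr_normcE z : normc z ^+ 2 = complex.Re z ^+ 2 + complex.Im z ^+ 2.
Proof. by case: z => a b /=; rewrite sqr_sqrtr// addr_ge0 ?sqr_ge0. Qed.

Lemma ler_normc z c : (normc z <= normc c) =
  (complex.Re z ^+ 2 + complex.Im z ^+ 2 <= complex.Re c ^+ 2 + complex.Im c ^+ 2).
Proof. by rewrite -!sqr_normcE ler_sqr ?nnegrE ?normc_ge0. Qed.

Lemma conjc_neq z c : Pi z -> Pi c -> z - conjc c != 0.
Proof.
case: z c => [x y] [a b]; rewrite /Pi /= => y0 b0.
apply/eqP => -[_ /eqP]; rewrite opprK; apply/negP.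
by rewrite lt0r_neq0// addr_gt0.
Qed.

(* For 0 < rho < 1, a closed pseudo-hyperbolic disc: a compact subset of Pi. *)
Definition pdisc (c : C) (rho : R) : set C :=
  [set z | normc (z - c) <= rho * normc (z - conjc c)].

Lemma pdisc_Pi c rho : Pi c -> 0 < rho < 1 -> pdisc c rho `<=` @Pi R.
Proof.
move=> c0 /andP[r0 r1] z; rewrite /pdisc /= => hz; rewrite /Pi /= ltNge.
apply/negP => z0.
have h : normc (z - conjc c) <= normc (z - c).
  rewrite ler_normc; case: z c c0 z0 {hz} => [x y] [a b].
  rewrite /Pi /= => b0 y0; nra.
have h0 : normc (z - conjc c) <= 0.
  have := le_trans h hz; have := normc_ge0 (z - conjc c); nra.
have : normc (z - c) == 0.
  rewrite eq_le normc_ge0 andbT; apply: le_trans hz _.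
  by rewrite mulr_ge0_le0// ltW.
rewrite normc_eq0 subr_eq0 => /eqP zc; move: c0; rewrite /Pi /= -zc.
by rewrite ltNge z0.
Qed.

Lemma normc_dist_continuous c : continuous (fun z => normc (z - c) : R).
Proof.
apply: continuous_real => z w; apply: le_trans (normc_dist _ _) _.
by rewrite opprB addrA subrK.
Qed.

Lemma pdisc_gap_continuous c (rho : R) :
  continuous (fun z => rho * normc (z - conjc c) - normc (z - c)).
Proof.
move=> z; have h1 := @normc_dist_continuous (conjc c) z.
exact: (cvgB (cvgM (cvg_cst rho) h1) (@normc_dist_continuous c z)).
Qed.

Lemma pdisc_compact c rho : Pi c -> 0 < rho < 1 -> compact (pdisc c rho).
Proof.
move=> c0 /andP[r0 r1].
(* From |z - conj c| <= |z - c| + 2 Im c, membership in the disc gives (1 - rho) |z - c| <= 2 rho Im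
   c. *)
set L := 2 * rho * complex.Im c / (1 - rho).
pose box := `[complex.Re c - L, complex.Re c + L] `*`
            `[complex.Im c - L, complex.Im c + L].
apply: (@subclosed_compact _ _ (@complex_of_pair R @` box)).
- have -> : pdisc c rho =
    (fun z => rho * normc (z - conjc c) - normc (z - c)) @^-1` [set r | 0 <= r].
    by apply/seteqP; split=> z; rewrite /pdisc /= subr_ge0.
  apply: closed_comp; last exact: closed_ge.
  by move=> z _; exact: pdisc_gap_continuous.
- apply: continuous_compact.
    by apply: continuous_subspaceT; exact: complex_of_pair_continuous.
  by apply: compact_setX; exact: segment_compact.
move=> z hz; exists (complex.Re z, complex.Im z); last by case: z {hz}.
have hL : normc (z - c) <= L.
  rewrite /L ler_pdivlMr; last by rewrite subr_gt0.
  have : normc (z - conjc c) <= normc (z - c) + 2 * complex.Im c.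
    have -> : z - conjc c = (z - c) + (c - conjc c) by ring.
    apply: le_trans (le_normcD _ _) _; rewrite lerD2l.
    case: c c0 {hz L box} => [a b]; rewrite /Pi /= => b0.
    rewrite subrr expr0n add0r sqrtr_sqr opprK ger0_norm; last lra.
    lra.
  move: hz; rewrite /pdisc /=; move: (normc_ge0 (z - conjc c)).
  move: (normc_ge0 (z - c)).
  move: (normc _) (normc _) => A B A0 B0 h1 h2; nra.
have := le_trans (normc_Re (z - c)) hL.
have := le_trans (normc_Im (z - c)) hL.
have -> : complex.Re (z - c) = complex.Re z - complex.Re c by case: (z) (c) => ? ? [].
have -> : complex.Im (z - c) = complex.Im z - complex.Im c by case: (z) (c) => ? ? [].
rewrite !ler_norml => /andP[h1 h2] /andP[h3 h4].
by split; rewrite /= in_itv /=; apply/andP; split; lra.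
Qed.

(** On the boundary of [pdisc c rho] the factor (z - c) / (z - conj c) has modulus rho, so |g| <= 1
    / rho there; the maximum principle carries the bound inside, and rho tends to 1. *)
Lemma schwarz_half_plane s g c : Pi c ->
  (forall z, Pi z -> normc (s z) <= 1) ->
  (forall z, Pi z -> ratio_at g z) ->
  (forall z, Pi z -> s z = (z - c) / (z - conjc c) * g z) ->
  forall z, Pi z -> normc (g z) <= 1.
Proof.
move=> c0 s1 gr sE z0 z00.
set beta := normc (z0 - c) / normc (z0 - conjc c).
have d0 : 0 < normc (z0 - conjc c) by rewrite normc_gt0 conjc_neq.
have beta1 : beta < 1.
  rewrite ltr_pdivrMr// mul1r ltNge ler_normc -ltNge.
  case: z0 c c0 z00 {beta d0 sE} => [x y] [a b]; rewrite /Pi /= => b0 y0; nra.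
suff main rho : 0 < rho < 1 -> beta <= rho -> rho * normc (g z0) <= 1.
  rewrite leNgt; apply/negP => G1.
  have G0 : 0 < normc (g z0) by lra.
  (* The midpoint between 1 / |g z0| and 1: a radius below 1 with r |g z0| > 1. *)
  pose r := (1 + (normc (g z0))^-1) / 2.
  have Gi1 : (normc (g z0))^-1 < 1 by rewrite invf_lt1.
  have Gi0 : 0 < (normc (g z0))^-1 by rewrite invr_gt0.
  have := main (Num.max beta r); rewrite lt_max gt_max beta1 le_max lexx.
  have -> : 0 < r by rewrite /r; lra.
  have -> : r < 1 by rewrite /r; lra.
  rewrite orbT => /(_ isT isT); apply/negP; rewrite -ltNge.
  have : 1 < r * normc (g z0).
    by rewrite /r mulrAC mulrDl mulVf ?lt0r_neq0//; lra.
  move=> h; apply: lt_le_trans h _.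
  by rewrite ler_pM2r// le_max lexx orbT.
move=> r01 br; have /andP[r0 r1] := r01.
have PiK := pdisc_Pi c0 r01.
have cK := pdisc_compact c0 r01.
set K := pdisc c rho in PiK cK.
have Kz0 : K z0 by rewrite /K /pdisc /= -ler_pdivrMr.
pose phi z : R := normc (g z).
have phic z : Pi z -> phi x @[x --> z] --> phi z.
  move=> Pz; apply: (continuous_comp (f := g)).
    exact: (ratio_continuous (gr z Pz)).
  exact: normc_continuous.
have phiK : {within K, continuous phi}.
  by apply: continuous_in_subspaceT => z /set_mem /PiK; exact: phic.
have [c1 /set_mem Kc1 max1] := compact_EVT_max (ex_intro _ z0 Kz0) cK phiK.
(* |g| is locally constant at its interior maxima, so a maximum point with
   largest imaginary part lies on the boundary of K. *)
pose S := [set z | K z /\ phi z = phi c1].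
have cS : compact S.
  apply: (subclosed_compact _ cK); last by move=> z [].
  rewrite closedE => z hz.
  have Kz : K z.
    have : closed K by apply: compact_closed => //; exact: norm_hausdorff.
    rewrite closedE; apply => /near_normcP[e e0 h]; apply: hz.
    by apply/near_normcP; exists e => // w /h hw -[].
  split => //; apply/eqP/negPn/negP => neq; apply: hz.
  have neq0 : phi z - phi c1 != 0 by rewrite subr_eq0.
  have : \forall w \near z, phi w - phi c1 != 0.
    apply: (@cvgr_neq0 _ _ _ (nbhs z) _ _ (phi z - phi c1)) => //.
    exact: (cvgB (phic z (PiK _ Kz)) (cvg_cst _)).
  move=> /near_normcP[e e0 h].
  apply/near_normcP; exists e => // w /h; rewrite subr_eq0.
  by move=> /eqP hw [_].
have [c2 /set_mem [Kc2 phi2] max2] : exists2 c2, c2 \in S &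
    forall t, t \in S -> complex.Im t <= complex.Im c2.
  apply: compact_EVT_max => //; first by exists c1.
  by apply: continuous_subspaceT; exact: Im_continuous.
have [int|bdy] := ltP (normc (c2 - c)) (rho * normc (c2 - conjc c)); last first.
  have := s1 _ (PiK _ Kc2); rewrite sE; last exact: PiK.
  rewrite !normcM normcV; apply: le_trans.
  have h1 : normc (g z0) <= normc (g c2).
    by rewrite -/(phi c2) phi2; apply: max1; rewrite inE.
  apply: ler_pM => //; [exact: ltW|exact: normc_ge0|].
  rewrite ler_pdivlMr// normc_gt0 conjc_neq//; exact: PiK.
exfalso.
have : \forall z \near c2, K z.
  have : 0 < rho * normc (c2 - conjc c) - normc (c2 - c) by rewrite subr_gt0.
  move=> gap0.
  have : \forall z \near c2, 0 < rho * normc (z - conjc c) - normc (z - c).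
    apply: (@cvgr_gt _ _ (nbhs c2) _ _ _ (@pdisc_gap_continuous c rho c2)).
    exact: gap0.
  by move=> /near_normcP[e e0 h]; apply/near_normcP; exists e => // z /h;
     rewrite subr_gt0 => /ltW.
move=> nK.
have nmax : \forall z \near c2, normc (g z) <= normc (g c2).
  move: nK => /near_normcP[e e0 h]; apply/near_normcP; exists e => // z /h Kz.
  by rewrite -/(phi c2) phi2; apply: max1; rewrite inE.
have := local_maximum (gr _ (PiK _ Kc2)) nmax.
move=> /(near_and nK) /near_normcP[e e0 h].
have := h (c2 + (e / 2) *i).
rewrite [c2 + _]addrC addrK /= expr0n add0r sqrtr_sqr ger0_norm; last lra.
case; first lra.
move=> Kz gz; have := max2 ((e / 2) *i + c2).
rewrite inE => /(_ (conj Kz _)); rewrite /phi gz => /(_ phi2).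
case: c2 {max2 Kc2 phi2 int nK nmax h Kz gz} => x y /=; lra.
Qed.
End Schwarz.

(** * Positivity of the Pick kernel *)

Section SchurKernel.
Variable R : realType.
Notation C := (C R).
Implicit Types (z c : C) (f g p q s : C -> C) (l : seq (C * C)).

Definition schur s : Prop := forall z, Pi z -> ratio_at s z /\ normc (s z) <= 1.

Lemma normc_real (r : R) : 0 <= r -> normc (r%:C) = r.
Proof. by move=> r0; rewrite /= expr0n addr0 sqrtr_sqr ger0_norm. Qed.

Lemma schurZ (r : R) s : 0 <= r <= 1 -> schur s -> schur (fun z => r%:C * s z).
Proof.
move=> /andP[r0 r1] hs z /hs[[p [q [hp hq q0 /near_normcP[e e0 hsz]]]] s1]; split.
  exists (fun z => r%:C * p z), q; split.
  - exact: analyticZ hp.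
  - exact: hq.
  - exact: q0.
  - apply/near_normcP; exists e; first exact: e0.
    by move=> w /hsz ->; rewrite mulrA.
by rewrite normcM normc_real// mulr_ile1// normc_ge0.
Qed.

Lemma normc_conjc z : normc (conjc z) = normc z.
Proof. by case: z => x y /=; rewrite sqrrN. Qed.

Lemma blaschke_den_neq0 (a u : C) : normc a < 1 -> normc u <= 1 -> 1 - conjc a * u != 0.
Proof.
move=> a1 u1; rewrite subr_eq0; apply/eqP => h.
have : normc (conjc a * u) < 1.
  rewrite normcM normc_conjc; have := normc_ge0 a; have := normc_ge0 u; nra.
by rewrite -h normc1 ltxx.
Qed.

Lemma blaschke_le1 (a u : C) : normc a < 1 -> normc u <= 1 ->
  normc ((u - a) / (1 - conjc a * u)) <= 1.
Proof.
move=> a1 u1; have D0 := blaschke_den_neq0 a1 u1.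
rewrite normcM normcV ler_pdivrMr ?normc_gt0// mul1r ler_normc.
have a2 : normc a ^+ 2 < 1 by rewrite expr_lt1// normc_ge0.
have u2 : normc u ^+ 2 <= 1 by rewrite expr_le1// normc_ge0.
rewrite sqr_normcE in a2; rewrite sqr_normcE in u2.
case: a u a2 u2 {a1 u1 D0} => [a b] [x y] /= h1 h2.
(* This product equals |1 - conj a u|^2 - |u - a|^2. *)
have : 0 <= (1 - (a ^+ 2 + b ^+ 2)) * (1 - (x ^+ 2 + y ^+ 2)).
  by rewrite mulr_ge0// subr_ge0// ltW.
move=> h; rewrite -subr_ge0; apply: le_trans h _.
by rewrite le_eqVlt; apply/orP; left; apply/eqP; ring.
Qed.

Lemma mobius_ratio (a b P Q S : C) : Q != 0 -> S = P / Q ->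
  (S - a) / (1 - b * S) = (P - a * Q) / (Q - b * P).
Proof.
move=> Q0 ->; have -> : P / Q - a = (P - a * Q) / Q by field.
have -> : 1 - b * (P / Q) = (Q - b * P) / Q by field.
by rewrite invf_div mulrA divfK.
Qed.

(** The Moebius image of s vanishes at c, so the Blaschke factor of c divides it, and the Schwarz
    lemma bounds the quotient by 1. [P1], the series of p - s(c) q divided by z - c, supplies both
    the value [L] at the removable point and the ratio form of g near it. *)
Lemma schur_reduction s c : schur s -> Pi c -> normc (s c) < 1 ->
  exists2 g, schur g & forall z, Pi z ->
    (s z - s c) / (1 - conjc (s c) * s z) = (z - c) / (z - conjc c) * g z.
Proof.
move=> hs c0 a1; set a := s c in a1 *.
have [[p [q [hp hq qc0 hpq]]] _] := hs c c0.
have Pan := analyticB hp (analyticZ a hq).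
have Pc : p c - a * q c = 0.
  by rewrite /a (nbhs_singleton hpq) divfK// subrr.
have [b /power_series_tail[P1 hP1 PE]] := Pan.
have {hP1} P1an : analytic_at P1 c by exists (fun k => b k.+1).
pose L := P1 c * (c - conjc c) / (q c - conjc a * p c).
pose g z := if z == c then L else
  (s z - a) / (1 - conjc a * s z) * ((z - conjc c) / (z - c)).
have D0 z : Pi z -> 1 - conjc a * s z != 0.
  by move=> /hs[_ sz]; exact: blaschke_den_neq0.
have gE z : Pi z ->
    (s z - a) / (1 - conjc a * s z) = (z - c) / (z - conjc c) * g z.
  move=> Pz; rewrite /g; case: eqP => [->|/eqP zc].
    by rewrite -/a !subrr !mul0r.
  field; rewrite [z - c == 0]subr_eq0 zc conjc_neq//= andbT; exact: D0.
exists g; last exact: gE.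
have g1 : forall z, Pi z -> ratio_at g z; last first.
  move=> z Pz; split; first exact: g1.
  apply: (@schwarz_half_plane _ (fun z => (s z - a) / (1 - conjc a * s z)) g c c0 _ g1 gE z Pz).
  by move=> w /hs[_ sw]; exact: blaschke_le1.
move=> z Pz; have [zc|zc] := eqVneq z c.
  rewrite {}zc.
  exists (fun z => (z - conjc c) * P1 z), (fun z => q z - conjc a * p z); split.
  - exact: analyticM_linear P1an.
  - exact: analyticB hq (analyticZ _ hp).
  - have := D0 c c0; rewrite -/a; apply: contraNneq => h.
    suff -> : 1 - conjc a * a = (q c - conjc a * p c) / q c by rewrite h mul0r.
    have ac : a = p c / q c by exact: nbhs_singleton hpq.
    by rewrite {2}ac; field.
  - have /near_normcP[e e0 h] := near_and PE (near_and hpq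
      (near_neq0 (analytic_continuous hq) qc0)).
    apply/near_normcP; exists e; first exact: e0.
    move=> w /h[hw [sw qw]]; rewrite /g; case: eqP => [->|/eqP wc].
      by rewrite /L [P1 c * _]mulrC.
    rewrite (mobius_ratio _ _ qw sw) hw Pc add0r.
    move: (_^-1 : C) => E; field.
    by rewrite subr_eq0.
have [p' [q' [hp' hq' q0' hpq']]] := (hs z Pz).1.
exists (fun w => (w - conjc c) * (p' w - a * q' w)),
  (fun w => (w - c) * (q' w - conjc a * p' w)); split.
- apply: analyticM_linear; exact: analyticB hp' (analyticZ _ hq').
- apply: analyticM_linear; exact: analyticB hq' (analyticZ _ hp').
- apply: mulf_neq0; first by rewrite subr_eq0.
  have := D0 z Pz; apply: contraNneq => h.
  suff -> : 1 - conjc a * s z = (q' z - conjc a * p' z) / q' z by rewrite h mul0r.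
  by rewrite (nbhs_singleton hpq'); field.
have zc' : z - c != 0 by rewrite subr_eq0.
have cz : w - c @[w --> z] --> z - c by exact: (cvgB cvg_id (cvg_cst c)).
have /near_normcP[e e0 h] := near_and (near_neq0 cz zc')
   (near_and hpq' (near_neq0 (analytic_continuous hq') q0')).
apply/near_normcP; exists e; first exact: e0.
move=> w /h[wc [sw qw]]; rewrite /g -subr_eq0 (negPf wc).
rewrite (mobius_ratio _ _ qw sw) invfM.
move: ((q' w - _)^-1 : C) => E; field.
exact: wc.
Qed.

(** The Hermitian form of the Schur kernel of the half-plane on a list of pairs (weight, point); a
    list, since a Schur step changes all weights and drops a point. *)
Definition kernel_sum s l : C := \sum_(u <- l) \sum_(v <- l)
  u.1 * conjc v.1 * ((1 - s u.2 * conjc (s v.2)) / (- 'i * (u.2 - conjc v.2))).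

Lemma kernel_sum0 s l z : kernel_sum s ((0, z) :: l) = kernel_sum s l.
Proof.
rewrite /kernel_sum big_cons /= big1 ?add0r; last by move=> i _; rewrite !mul0r.
by apply: eq_bigr => u _; rewrite big_cons (_ : conjc _ = 0) ?mulr0 ?mul0r ?add0r//; exact: conjc0.
Qed.

Lemma mul_conjc_normc (u : C) : u * conjc u = (normc u ^+ 2)%:C.
Proof. by rewrite -sqr_normc norm_normc rmorphXn. Qed.

Lemma conjcD z c : conjc (z + c) = conjc z + conjc c.
Proof. exact: (rmorphD (@conjc R)). Qed.

Lemma conjcB z c : conjc (z - c) = conjc z - conjc c.
Proof. exact: (rmorphB (@conjc R)). Qed.

Lemma conjcM z c : conjc (z * c) = conjc z * conjc c.
Proof. exact: (rmorphM (@conjc R)). Qed.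

Lemma conjc_div z c : conjc (z / c) = conjc z / conjc c.
Proof. by rewrite conjcM conjc_inv. Qed.

Lemma conjc_sum (T : Type) (r : seq T) (F : T -> C) :
  conjc (\sum_(i <- r) F i) = \sum_(i <- r) conjc (F i).
Proof. exact: (rmorph_sum (@conjc R)). Qed.

(** The variables w, c', a', T, h stand for conjugates, made independent so that [field] applies.
    With the Blaschke factors b = (z - c) / (z - c') and b' = (w - c') / (w - c), the source is 1 -
    b b' g h = (1 - b b') + b b' (1 - g h): divided by -i (z - w), the first summand separates into
    a function of z times a function of w. *)
Lemma kernel_identity (z w c c' a a' S T g h : C) :
  1 - a' * S != 0 -> 1 - a * T != 0 -> 1 - a * a' != 0 ->
  z - c' != 0 -> w - c != 0 -> z - w != 0 ->
  (S - a) / (1 - a' * S) = (z - c) / (z - c') * g ->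
  (T - a') / (1 - a * T) = (w - c') / (w - c) * h ->
  (1 - S * T) / (- 'i * (z - w)) = (1 - a * a')^-1 *
   (- 'i * (c - c') * ((1 - a' * S) / (z - c') * ((1 - a * T) / (w - c))) +
    (1 - a' * S) * ((z - c) / (z - c')) * ((1 - a * T) * ((w - c') / (w - c))) *
    ((1 - g * h) / (- 'i * (z - w)))).
Proof.
move=> D0 E0 a0 zc wc zw Sg Th.
have i0 : 'i != 0 :> C by rewrite eq_complex /= eqxx oner_eq0.
have -> : 1 - S * T = (1 - a' * S) * (1 - a * T) / (1 - a * a') *
   (1 - (S - a) / (1 - a' * S) * ((T - a') / (1 - a * T))).
  by field; rewrite D0 E0 a0.
rewrite Sg Th.
have i2 : 'i * 'i = -1 :> C by rewrite -expr2 sqr_i.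
have -> : - 'i * (c - c') = - (c - c') * ('i * 'i) / 'i by field.
rewrite i2; field.
by rewrite i0 zc wc zw a0.
Qed.

(** The form of s is a positive multiple of a square plus the form of g with new weights. Each new
    weight contains the factor z - c, so the point c itself drops out. *)
Lemma kernel_step s g c l : Pi c -> normc (s c) < 1 ->
  (forall u, u \in l -> Pi u.2) ->
  (forall z, Pi z -> normc (s z) <= 1) ->
  (forall z, Pi z ->
    (s z - s c) / (1 - conjc (s c) * s z) = (z - c) / (z - conjc c) * g z) ->
  let D z := 1 - conjc (s c) * s z in
  let S := \sum_(u <- l) u.1 * D u.2 / (u.2 - conjc c) in
  kernel_sum s l = (1 - s c * conjc (s c))^-1 *
   (- 'i * (c - conjc c) * (S * conjc S) +
    kernel_sum g [seq (u.1 * D u.2 * ((u.2 - c) / (u.2 - conjc c)), u.2) | u <- l]).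
Proof.
move=> c0 sc1 lPi s1 gE D S.
have Dc z : conjc (D z) = 1 - s c * conjc (s z).
  by rewrite conjcB conjcM conjcK conjc1.
have D0 z : Pi z -> D z != 0 by move=> /s1; exact: blaschke_den_neq0.
have a0 : 1 - s c * conjc (s c) != 0.
  by have := D0 c c0; rewrite /D mulrC.
rewrite /kernel_sum big_map conjc_sum mulr_suml mulr_sumr -big_split mulr_sumr /=.
apply: eq_big_seq => u /lPi uPi.
rewrite big_map mulr_sumr mulr_sumr -big_split mulr_sumr /=.
apply: eq_big_seq => v /lPi vPi.
have Dv0 : 1 - s c * conjc (s v.2) != 0 by rewrite -Dc conjc_eq0 D0.
have vc : conjc v.2 - c != 0.
  by rewrite -[c]conjcK -conjcB conjc_eq0 conjc_neq.
have gv : (conjc (s v.2) - conjc (s c)) / (1 - s c * conjc (s v.2)) =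
    (conjc v.2 - conjc c) / (conjc v.2 - c) * conjc (g v.2).
  rewrite -conjcB -Dc -conjc_div gE// conjcM conjc_div !conjcB conjcK.
  by [].
rewrite (kernel_identity (D0 _ uPi) Dv0 a0 (conjc_neq uPi c0) vc
   (conjc_neq uPi vPi) (gE _ uPi) gv).
rewrite !conjcM !conjc_inv !Dc !conjcB conjcK /D.
move: (1 - _ * conjc (s v.2)) (1 - _ * s u.2) (_^-1 : C) (_^-1 : C) (_^-1 : C).
move=> *; ring.
Qed.

Lemma kernel_sum_ge0 s l : schur s -> (forall u, u \in l -> Pi u.2) ->
  0 <= kernel_sum s l.
Proof.
move: {2}(size l) (leqnn (size l)) => n; elim: n s l => [|n ih] s l.
  by rewrite leqn0 => /nilP -> _ _; rewrite /kernel_sum big_nil.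
move=> ln hs lPi.
(* Multiplying s by t < 1 excludes |s c| = 1, where the reduction degenerates. *)
have strict (t : R) : 0 <= t < 1 -> 0 <= kernel_sum (fun z => t%:C * s z) l.
  move=> /andP[t0 t1].
  case: l ln lPi => [_ _|[d c] l ln lPi]; first by rewrite /kernel_sum big_nil.
  have c0 : Pi c by apply: (lPi (d, c)); rewrite mem_head.
  have hts : schur (fun z => t%:C * s z) by apply: schurZ => //; rewrite t0 ltW.
  have ts1 : normc (t%:C * s c) < 1.
    rewrite normcM normc_real//; have := (hs c c0).2.
    have := normc_ge0 (s c); nra.
  have [g hg gE] := schur_reduction hts c0 ts1.
  rewrite (kernel_step c0 ts1 lPi _ gE); last by move=> z /hts[].
  rewrite /= subrr mul0r mulr0 kernel_sum0.
  apply: mulr_ge0.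
    rewrite invr_ge0 mul_conjc_normc subr_ge0 -(rmorph1 (real_complex R)) lecR.
    by rewrite expr_le1 ?normc_ge0// ltW.
  apply: addr_ge0.
    apply: mulr_ge0; last by rewrite mul_conjc_normc ler0c sqr_ge0.
    case: c c0 {ln lPi ts1 gE} => x y; rewrite /Pi /= => y0; simpc.
    by rewrite addr_ge0// ltW.
  apply: ih => //; first by rewrite size_map.
  by move=> u /mapP[v vl ->] /=; apply: lPi; rewrite inE vl orbT.
(* The form of t * s is A - t^2 B, so positivity for t < 1 passes to t = 1. *)
pose A : C := \sum_(u <- l) \sum_(v <- l)
  u.1 * conjc v.1 * (1 / (- 'i * (u.2 - conjc v.2))).
pose B : C := \sum_(u <- l) \sum_(v <- l)
  u.1 * conjc v.1 * (s u.2 * conjc (s v.2) / (- 'i * (u.2 - conjc v.2))).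
have KE (t : R) : kernel_sum (fun z => t%:C * s z) l = A - (t ^+ 2)%:C * B.
  rewrite /kernel_sum /A /B mulr_sumr -sumrB; apply: eq_bigr => u _.
  rewrite mulr_sumr -sumrB; apply: eq_bigr => v _.
  by rewrite conjcM conjc_real rmorphXn /=; ring.
have -> : kernel_sum s l = A - B.
  rewrite /A /B -sumrB; apply: eq_bigr => u _.
  rewrite -sumrB; apply: eq_bigr => v _; ring.
have hA : 0 <= A.
  by have := strict 0; rewrite lexx ltr01 KE expr0n mul0r subr0 => /(_ isT).
have h t : 0 <= t < 1 -> 0 <= A - t%:C * B.
  move=> /andP[t0 t1]; have := strict (Num.sqrt t).
  rewrite sqrtr_ge0 -[X in _ < X]sqrtr1 ltr_sqrt// t1 => /(_ isT).
  by rewrite KE sqr_sqrtr.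
move: hA h; case: A {KE} => a a'; case: B => b b'.
rewrite lecE /= => /andP[/eqP -> a0] h.
have {}h (t : R) : 0 <= t < 1 -> t * b' = 0 /\ t * b <= a.
  move=> /h; simpc => /andP[/eqP h1 h2].
  by split; lra.
simpc.
have [|hb' _] := h 2^-1.
  by rewrite invr_ge0 ler0n invf_lt1 ?ltr0n// ltr1n.
apply/andP; split; first by apply/eqP; lra.
rewrite subr_ge0 leNgt; apply/negP => ab.
have b0 : 0 < b by lra.
(* If a < b, this t lies in [0, 1) while t b = (a + b) / 2 exceeds a. *)
have [|_] := h ((1 + a / b) / 2).
  have : a / b < 1 by rewrite ltr_pdivrMr// mul1r.
  have : 0 <= a / b by rewrite divr_ge0// ltW.
  by move=> h1 h2; apply/andP; split; lra.
have -> : (1 + a / b) / 2 * b = (a + b) / 2 by field; lra.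
lra.
Qed.
End SchurKernel.

Section PickKernel.
Variable R : realType.
Notation C := (C R).
Implicit Types (z c : C) (f g p q s : C -> C) (l : seq (C * C)).

Definition pick_kernel f z c : C := (f z - conjc (f c)) / (z - conjc c).

Lemma cayley_schur f : pick_class f -> schur (fun z => (f z - 'i) / (f z + 'i)).
Proof.
move=> hf z /hf[an im]; split.
  exists (fun z => f z - 'i), (fun z => f z + 'i); split.
  - exact: analyticB an (analytic_cst _ _).
  - exact: analyticD an (analytic_cst _ _).
  - case: (f z) im => a b /= b0; rewrite eq_complex /= negb_and orbC.
    by rewrite lt0r_neq0//; lra.
  - by apply/near_normcP; exists 1.
suff: normc ((f z - 'i) / (f z + 'i)) <= 1 by [].
case: (f z) im => a b b0; rewrite /= in b0.
have h0 : (a +i* b) + 'i != 0 :> C.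
  rewrite eq_complex /= negb_and orbC.
  by rewrite lt0r_neq0//; lra.
rewrite normcM normcV ler_pdivrMr ?normc_gt0// mul1r ler_normc /=; nra.
Qed.

Lemma pick_kernel_ge0 f l : pick_class f -> (forall u, u \in l -> Pi u.2) ->
  0 <= \sum_(u <- l) \sum_(v <- l) u.1 * conjc v.1 * pick_kernel f u.2 v.2.
Proof.
move=> hf lPi.
pose s z := (f z - 'i) / (f z + 'i).
(* With these weights the denominators of the Cayley transform cancel, and its Schur kernel becomes
   twice the Pick kernel of f. *)
have := @kernel_sum_ge0 R s [seq (u.1 * (f u.2 + 'i), u.2) | u <- l] (cayley_schur hf).
have -> : kernel_sum s [seq (u.1 * (f u.2 + 'i), u.2) | u <- l] =
   2 * \sum_(u <- l) \sum_(v <- l) u.1 * conjc v.1 * pick_kernel f u.2 v.2.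
  rewrite /kernel_sum big_map mulr_sumr; apply: eq_big_seq => u /lPi uPi.
  rewrite big_map mulr_sumr; apply: eq_big_seq => v /lPi vPi /=.
  have f0 z : Pi z -> f z + 'i != 0.
    move=> /hf[_]; case: (f z) => a b /= b0; rewrite eq_complex /= negb_and orbC.
    by rewrite lt0r_neq0//; lra.
  have i0 : 'i != 0 :> C by rewrite eq_complex /= eqxx oner_eq0.
  have conji : conjc 'i = - 'i :> C by simpc.
  have := f0 _ vPi; rewrite -conjc_eq0 conjcD conji => fv.
  have i2 : - 'i * (f u.2 - conjc (f v.2)) * 2 =
      (f u.2 + 'i) * (conjc (f v.2) - 'i) - (f u.2 - 'i) * (conjc (f v.2) + 'i).
    by ring.
  rewrite /s /pick_kernel conjcM conjcD conji conjc_div conjcB conjcD conji opprK.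
  have -> : 1 - (f u.2 - 'i) / (f u.2 + 'i) * ((conjc (f v.2) + 'i) / (conjc (f v.2) - 'i)) =
    - 'i * (f u.2 - conjc (f v.2)) * 2 / ((f u.2 + 'i) * (conjc (f v.2) - 'i)).
    by rewrite i2; field; rewrite fv f0.
  field.
  by rewrite conjc_neq// i0 fv f0.
rewrite pmulr_rge0 ?ltr0n//; apply=> u /mapP[v vl ->]; exact: (lPi v).
Qed.

Lemma cvgn_sum (I : Type) (r : seq I) (F : I -> nat -> C) (L : I -> C) :
  (forall i, F i @ \oo --> L i) ->
  (fun k => \sum_(i <- r) F i k) @ \oo --> \sum_(i <- r) L i.
Proof.
move=> h; elim: r => [|i r ih].
  rewrite big_nil; under eq_fun do rewrite big_nil; exact: cvg_cst.
rewrite big_cons; under eq_fun do rewrite big_cons.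
exact: (cvgD (h i) ih).
Qed.

Lemma cvgn_conjc (u : nat -> C) c : u @ \oo --> c ->
  (fun k => conjc (u k) : C) @ \oo --> (conjc c : C).
Proof.
move=> /cvgn_normcP h; apply/cvgn_normcP => e e0.
have [N _ hN] := h e e0; exists N => // k Nk.
by rewrite -conjcB normc_conjc; exact: hN.
Qed.

Lemma derive_limit (F : C -> C) c v : is_derive c 1 F v ->
  forall e : R, 0 < e -> exists2 d : R, 0 < d &
  forall h : C, h != 0 -> normc h < d -> normc ((F (c + h) - F c) / h - v) < e.
Proof.
move=> [dF dE] e e0.
have : (fun h : C => h^-1 *: ((F \o shift c) (h *: (1 : C)) - F c)) @ 0^' --> v.
  by rewrite -dE; exact: dF.
move=> /cvgrPdist_lt /(_ e%:C); rewrite ltcR => /(_ e0).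
move=> /near_normcP[d d0 hd]; exists d => // h h0 hlt.
have := hd h; rewrite subr0 => /(_ hlt h0) /=.
rewrite distrC norm_normc ltcR /shift /= [_ *: _](_ : _ = (F (c + h) - F c) / h)//.
rewrite -[LHS]/(h^-1 * (F (h * 1 + c) - F c)).
by rewrite mulr1 mulrC [h + c]addrC.
Qed.
End PickKernel.

(** * Boundary limits of the Pick kernel *)

Section Boundary.
Variables (R : realType) (n : nat) (x w v : 'I_n -> R).
Notation C := (C R).
Hypothesis x_inj : injective x.
Variable f : C -> C.
Hypothesis hf : solution x w v f.

Let Z j k : C := (x j)%:C + (harmonic k)%:C * 'i.
Let q j k : C := (f (Z j k) - (w j)%:C) / ((harmonic k)%:C * 'i).

Lemma approach_Pi j k : Pi (Z j k).
Proof.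
suff: 0 < complex.Im (Z j k) by [].
have -> : complex.Im (Z j k) = harmonic k by rewrite /Z /=; ring.
exact: harmonic_gt0.
Qed.

Lemma boundary_quotient j : q j @ \oo --> ((v j)%:C : C).
Proof.
have [_ /(_ j)[F [[U [Uo Ux _ FU]] Fx dF]]] := hf.
apply/cvgn_normcP => e /(derive_limit dF)[d d0 hd].
have /near_normcP[d' d'0 hU] : nbhs ((x j)%:C : C) U by exact: open_nbhs_nbhs.
near=> k.
have hk0 : 0 < harmonic k :> R by exact: harmonic_gt0.
have hkd : harmonic k < Num.min d d'.
  near: k; apply: (cvgr_lt (0 : R)); first exact: cvg_harmonic.
  by rewrite lt_min d0.
move: hkd; rewrite lt_min => /andP[kd kd'].
have hn : normc ((harmonic k)%:C * 'i : C) = harmonic k.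
  by rewrite normcM normc_real ?ltW//= expr0n expr1n add0r sqrtr1 mulr1.
have h0 : (harmonic k)%:C * 'i != 0 :> C by rewrite -normc_gt0 hn.
have -> : q j k = (F ((x j)%:C + (harmonic k)%:C * 'i) - F (x j)%:C) / ((harmonic k)%:C * 'i).
  rewrite /q Fx FU//.
    by apply: hU; rewrite addrC addKr hn.
  exact: approach_Pi.
by apply: hd => //; rewrite hn.
Unshelve. all: end_near. Qed.

Lemma harmonicC : (fun k => (harmonic k)%:C * 'i : C) @ \oo --> (0 : C).
Proof.
apply/cvgn_normcP => e e0; near=> k.
have hk0 : 0 < harmonic k :> R by exact: harmonic_gt0.
rewrite subr0 normcM normc_real ?ltW//= expr0n expr1n add0r sqrtr1 mulr1.
by near: k; apply: (cvgr_lt (0 : R)); [exact: cvg_harmonic|].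
Unshelve. all: end_near. Qed.

Lemma cvg_approach j : Z j @ \oo --> ((x j)%:C : C).
Proof.
rewrite -[X in _ --> X]addr0; exact: (cvgD (cvg_cst _) harmonicC).
Qed.

Lemma cvg_solution j : (fun k => f (Z j k)) @ \oo --> ((w j)%:C : C).
Proof.
have -> : (fun k => f (Z j k)) = (fun k => (w j)%:C + ((harmonic k)%:C * 'i) * q j k).
  apply/funext => k; rewrite /q mulrC divfK; first by rewrite addrC subrK.
  have hk0 : 0 < harmonic k :> R by exact: harmonic_gt0.
  rewrite mulf_neq0//; first by rewrite eq_complex /= eqxx andbT lt0r_neq0.
  by rewrite eq_complex /= eqxx oner_eq0.
rewrite -[X in _ --> X]addr0 -[X in _ + X](mul0r ((v j)%:C)).
exact: (cvgD (cvg_cst _) (cvgM harmonicC (@boundary_quotient j))).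
Qed.

(** On the diagonal the kernel is Im f / Im z, which along the vertical through x_j is the real part
    of the difference quotient [q] because w_j is real. *)
Lemma cvg_kernel_diag j : (fun k => pick_kernel f (Z j k) (Z j k)) @ \oo --> ((v j)%:C : C).
Proof.
have -> : (fun k => pick_kernel f (Z j k) (Z j k)) = (fun k => (q j k + conjc (q j k)) * 2^-1).
  apply/funext => k; rewrite /pick_kernel /q /Z.
  have hk0 : 0 < harmonic k :> R by exact: harmonic_gt0.
  have h0 : (harmonic k)%:C != 0 :> C by rewrite eq_complex /= eqxx andbT lt0r_neq0.
  have i0 : 'i != 0 :> C by rewrite eq_complex /= eqxx oner_eq0.
  have conji : conjc 'i = - 'i :> C by simpc.
  rewrite conjc_div conjcB !conjcD !conjcM !conjc_real conji.
  have -> : (x j)%:C + (harmonic k)%:C * 'i - ((x j)%:C + (harmonic k)%:C * - 'i) =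
    2 * ((harmonic k)%:C * 'i) :> C by ring.
  by field; rewrite h0 i0.
have -> : (v j)%:C = ((v j)%:C + conjc ((v j)%:C)) * 2^-1 :> C.
  by rewrite conjc_real; field.
have hq := @boundary_quotient j.
exact: (cvgM (cvgD hq (cvgn_conjc hq)) (cvg_cst _)).
Qed.

Lemma cvg_kernel_off_diag i j : i != j -> (fun k => pick_kernel f (Z i k) (Z j k)) @ \oo -->
  (((w i - w j) / (x i - x j))%:C : C).
Proof.
move=> ij.
have -> : ((w i - w j) / (x i - x j))%:C =
    ((w i)%:C - conjc (w j)%:C) / ((x i)%:C - conjc (x j)%:C) :> C.
  by rewrite !conjc_real rmorphM fmorphV !rmorphB.
have x0 : (x i)%:C - conjc (x j)%:C != 0 :> C.
  by rewrite conjc_real -rmorphB fmorph_eq0 subr_eq0 (inj_eq x_inj).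
rewrite /pick_kernel.
have h1 := cvgB (@cvg_solution i) (cvgn_conjc (@cvg_solution j)).
have h2 := cvgV x0 (cvgB (@cvg_approach i) (cvgn_conjc (@cvg_approach j))).
exact: (cvgM (h1 _) (h2 _ _)).
Qed.

Lemma cvg_kernel_interior_r z j : Pi z -> (fun k => pick_kernel f z (Z j k)) @ \oo -->
  ((f z - (w j)%:C) / (z - (x j)%:C) : C).
Proof.
move=> zP; rewrite -(conjc_real (w j)) -(conjc_real (x j)).
have x0 : z - conjc (x j)%:C != 0 :> C.
  case: z zP => a b; rewrite /Pi /= => b0; rewrite eq_complex /= negb_and orbC.
  by rewrite oppr0 subr0 lt0r_neq0.
exact: (cvgM (cvgB (cvg_cst _) (cvgn_conjc (@cvg_solution j)))
   (cvgV x0 (cvgB (cvg_cst _) (cvgn_conjc (@cvg_approach j))))).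
Qed.

Lemma cvg_kernel_interior_l z j : Pi z -> (fun k => pick_kernel f (Z j k) z) @ \oo -->
  (conjc ((f z - (w j)%:C) / (z - (x j)%:C)) : C).
Proof.
move=> zP.
have -> : (fun k => pick_kernel f (Z j k) z) = (fun k => conjc (pick_kernel f z (Z j k)) : C).
  apply/funext => k; rewrite /pick_kernel conjc_div !conjcB !conjcK.
  by rewrite -mulrNN -invrN !opprB.
exact: (cvgn_conjc (@cvg_kernel_interior_r z j zP)).
Qed.

(** The limit of the kernel form at z with weight c and at points tending to the x_j with weights
    u_j. The cross term, linear in c, is what constrains f when u is a null vector. *)
Lemma fundamental_inequality (u : 'I_n -> R) (c z : C) : Pi z ->
  0 <= complex.Re (c * conjc c * pick_kernel f z z) +
       2 * complex.Re (c * \sum_j (u j)%:C * ((f z - (w j)%:C) / (z - (x j)%:C))) +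
       \sum_i \sum_j u i * u j * pick_matrix x w v i j.
Proof.
move=> zP.
set L : C := \sum_j (u j)%:C * _; set Q : R := \sum_i _.
pose S k := \sum_(a <- (c, z) :: [seq ((u j)%:C, Z j k) | j <- index_enum 'I_n])
   \sum_(b <- (c, z) :: [seq ((u j)%:C, Z j k) | j <- index_enum 'I_n])
   a.1 * conjc b.1 * pick_kernel f a.2 b.2.
have S0 k : 0 <= complex.Re (S k).
  have : 0 <= S k.
    apply: pick_kernel_ge0; first exact: hf.1.
    move=> a; rewrite inE => /orP[/eqP ->//|/mapP[j _ ->]]; exact: approach_Pi.
  by rewrite lecE => /andP[].
have SE : S = fun k => (c * conjc c * pick_kernel f z z +
   \sum_j c * (u j)%:C * pick_kernel f z (Z j k)) +
   \sum_i ((u i)%:C * conjc c * pick_kernel f (Z i k) z +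
     \sum_j (u i)%:C * (u j)%:C * pick_kernel f (Z i k) (Z j k)).
  apply/funext => k; rewrite /S big_cons big_cons !big_map /=.
  congr (_ + _ + _).
    by apply: eq_bigr => j _; congr (_ * _ * _); exact: conjc_real.
  apply: eq_bigr => i _; rewrite big_cons big_map /=; congr (_ + _).
  by apply: eq_bigr => j _; congr (_ * _ * _); exact: conjc_real.
have SL : S @ \oo --> (c * conjc c * pick_kernel f z z +
   \sum_j c * (u j)%:C * ((f z - (w j)%:C) / (z - (x j)%:C))) +
   \sum_i ((u i)%:C * conjc c * conjc ((f z - (w i)%:C) / (z - (x i)%:C)) +
     \sum_j (u i)%:C * (u j)%:C * (pick_matrix x w v i j)%:C).
  rewrite SE; apply: cvgD; first apply: cvgD; first exact: cvg_cst.
    apply: cvgn_sum => j; exact: (cvgM (cvg_cst _) (@cvg_kernel_interior_r z j zP)).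
  apply: cvgn_sum => i; apply: cvgD.
    exact: (cvgM (cvg_cst _) (@cvg_kernel_interior_l z i zP)).
  apply: cvgn_sum => j; apply: (cvgM (cvg_cst _)).
  rewrite mxE; case: eqP => [->|/eqP ij]; [exact: cvg_kernel_diag|exact: cvg_kernel_off_diag].
have lim0 : 0 <= complex.Re (c * conjc c * pick_kernel f z z +
   \sum_j c * (u j)%:C * ((f z - (w j)%:C) / (z - (x j)%:C)) +
   \sum_i ((u i)%:C * conjc c * conjc ((f z - (w i)%:C) / (z - (x i)%:C)) +
     \sum_j (u i)%:C * (u j)%:C * (pick_matrix x w v i j)%:C)).
  rewrite leNgt; apply/negP; set T := (X in complex.Re X) => neg.
  have e0 : 0 < - complex.Re T by rewrite oppr_gt0.
  have [N _ hN] := (cvgn_normcP S T).1 SL _ e0.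
  have := hN N (leqnn N); rewrite /=.
  move=> /(le_lt_trans (normc_Re _)); rewrite ltr_norml => /andP[_].
  have -> : complex.Re (S N - T) = complex.Re (S N) - complex.Re T.
    by case: (S N) (T) => ? ? [].
  have := S0 N; lra.
apply: le_trans lim0 _; rewrite le_eqVlt; apply/orP; left; apply/eqP.
have ReD (a b : C) : complex.Re (a + b) = complex.Re a + complex.Re b.
  by case: a b => ? ? [].
have -> : \sum_j c * (u j)%:C * ((f z - (w j)%:C) / (z - (x j)%:C)) = c * L.
  by rewrite /L mulr_sumr; apply: eq_bigr => j _; rewrite -[LHS]mulrA.
rewrite big_split /=.
have -> : \sum_i (u i)%:C * conjc c * conjc ((f z - (w i)%:C) / (z - (x i)%:C)) = conjc (c * L).
  rewrite conjcM /L conjc_sum mulr_sumr; apply: eq_bigr => j _.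
  by rewrite [in RHS]conjcM [conjc (u j)%:C]conjc_real; ring.
have -> : \sum_i \sum_j (u i)%:C * (u j)%:C * (pick_matrix x w v i j)%:C = Q%:C :> C.
  rewrite /Q rmorph_sum; apply: eq_bigr => i _ /=; rewrite rmorph_sum.
  by apply: eq_bigr => j _; rewrite !rmorphM.
rewrite !ReD /=.
have -> : complex.Re (conjc (c * L)) = complex.Re (c * L) by case: (c * L).
ring.
Qed.

Lemma solution_form_ge0 (u : 'I_n -> R) :
  0 <= \sum_i \sum_j u i * u j * pick_matrix x w v i j.
Proof.
have := @fundamental_inequality u 0 'i; rewrite /Pi /= ltr01 => /(_ isT).
by rewrite !mul0r /= mulr0 !add0r.
Qed.

Lemma solution_null (u : 'I_n -> R) z : Pi z ->
  \sum_i \sum_j u i * u j * pick_matrix x w v i j = 0 ->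
  \sum_j (u j)%:C * ((f z - (w j)%:C) / (z - (x j)%:C)) = 0 :> C.
Proof.
move=> zP Q0; set L : C := \sum_j (u j)%:C * _.
apply/eqP; rewrite -normc_eq0; apply/negPn/negP => L0.
set K := pick_kernel f z z.
(* For the weight -t conj L the inequality reads 0 <= t |L|^2 (t Re K - 2), and this t > 0 gives t
   Re K <= 1. *)
pose t : R := (1 + `|complex.Re K|)^-1.
have k0 : 0 < 1 + `|complex.Re K| by rewrite ltr_pwDl.
have := fundamental_inequality u (- t%:C * conjc L) zP.
rewrite Q0 addr0 -/L -/K.
have -> : - t%:C * conjc L * L = (- (t * normc L ^+ 2))%:C :> C.
  by rewrite -mulrA [conjc L * L]mulrC mul_conjc_normc mulNr -rmorphM -rmorphN.
have -> : - t%:C * conjc L * conjc (- t%:C * conjc L) * K =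
   (t ^+ 2 * normc L ^+ 2)%:C * K :> C.
  have nt : conjc (- t%:C) = - t%:C :> C by simpc.
  rewrite conjcM conjcK nt.
  have -> : (t ^+ 2 * normc L ^+ 2)%:C = t%:C ^+ 2 * (L * conjc L) :> C.
    by rewrite mul_conjc_normc rmorphM rmorphXn.
  by ring.
have -> : complex.Re ((t ^+ 2 * normc L ^+ 2)%:C * K) = t ^+ 2 * normc L ^+ 2 * complex.Re K.
  by case: (K) => a b /=; rewrite mul0r subr0.
rewrite /=; apply/negP; rewrite -ltNge.
have N0 : 0 < normc L ^+ 2 by rewrite exprn_gt0// lt_def L0 normc_ge0.
have t0 : 0 < t by rewrite invr_gt0.
have tK : t * complex.Re K <= 1.
  rewrite /t mulrC ler_pdivrMr// mul1r; apply: le_trans (ler_norm _) _.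
  by rewrite lerDr.
set N := normc L ^+ 2 in N0 *.
have -> : t ^+ 2 * N * complex.Re K + 2 * - (t * N) = (t * N) * (t * complex.Re K - 2).
  by ring.
have : 0 < t * N by rewrite mulr_gt0.
nra.
Qed.
End Boundary.

(** * Rational solutions *)

Section Rational.
Variable R : realType.
Notation C := (C R).
Implicit Types (p q : {poly C}) (c h z : C).

Definition poly_norm m p : R := \sum_(i < m) normc p`_i.

Lemma horner_norm m p h : (size p <= m)%N -> normc h <= 1 ->
  normc p.[h] <= poly_norm m p.
Proof.
move=> pm h1; rewrite (horner_coef_wide _ pm).
rewrite /poly_norm; elim/big_ind2: _ => [|a a' b b' ha hb|i _].
- by rewrite normc0.
- by apply: le_trans (le_normcD _ _) _; rewrite lerD.
- by rewrite normcM normcX ler_piMr ?normc_ge0// exprn_ile1 ?normc_ge0.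
Qed.

Lemma horner_drop1 p h : p.[h] = p`_0 + h * (drop_poly 1 p).[h].
Proof.
rewrite -[in LHS](poly_take_drop 1 p) hornerD hornerM hornerXn expr1 mulrC.
congr (_ + _); rewrite (horner_coef_wide _ (size_take_poly _ _)).
by rewrite big_ord1 expr0 mulr1 coef_take_poly.
Qed.

(* The remainders of the division of p by q in increasing powers: p / q equals
   a_0 + ... + a_(k-1) X^(k-1) + X^k (quotient_rest p q k) / q. *)
Fixpoint quotient_rest p q k : {poly C} :=
  if k is j.+1 then
    let r := quotient_rest p q j in drop_poly 1 (r - (r`_0 / q`_0) *: q)
  else p.

Lemma quotient_restE p q k h : q`_0 != 0 ->
  (quotient_rest p q k).[h] =
  (quotient_rest p q k)`_0 / q`_0 * q.[h] + h * (quotient_rest p q k.+1).[h].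
Proof.
move=> q0 /=; set r := quotient_rest p q k.
have := horner_drop1 (r - (r`_0 / q`_0) *: q) h.
rewrite coefB coefZ divfK// subrr add0r => <-.
by rewrite hornerD hornerN hornerZ addrC subrK.
Qed.

Lemma size_quotient_rest p q k m : (size p <= m)%N -> (size q <= m)%N ->
  (size (quotient_rest p q k) <= m)%N.
Proof.
move=> pm qm; elim: k => //= k ih.
rewrite size_drop_poly; apply: leq_trans (leq_subr _ _) _.
apply: leq_trans (size_polyD _ _) _.
rewrite size_polyN geq_max ih /=.
exact: leq_trans (size_scale_leq _ _) qm.
Qed.

(** Each division step enlarges the coefficient sum by at most one fixed factor; this geometric
    growth gives the expansion of p / q a positive radius. *)
Lemma quotient_rest_norm p q k m : (size p <= m)%N -> (size q <= m)%N ->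
  (0 < m)%N ->
  poly_norm m (quotient_rest p q k) <=
  (1 + poly_norm m q / normc q`_0) ^+ k * poly_norm m p.
Proof.
move=> pm qm m0.
have N0 (r : {poly C}) : 0 <= poly_norm m r by apply: sumr_ge0 => i _; exact: normc_ge0.
have shift (r : {poly C}) : (size r <= m)%N -> \sum_(i < m) normc r`_i.+1 <= poly_norm m r.
  case: m m0 {pm qm N0} => // m _ rm.
  rewrite /poly_norm big_ord_recr big_ord_recl /= nth_default// normc0 addr0.
  by rewrite lerDr normc_ge0.
elim: k => [|k ih]; first by rewrite expr0 mul1r.
have := size_quotient_rest k pm qm.
rewrite exprS -mulrA /=; move: ih; set r := quotient_rest p q k => ih rm.
apply: (@le_trans _ _ ((1 + poly_norm m q / normc q`_0) * poly_norm m r)); last first.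
  by rewrite ler_wpM2l// addr_ge0// divr_ge0// normc_ge0.
rewrite mulrDl mul1r.
apply: (@le_trans _ _ (\sum_(i < m) (normc r`_i.+1 + normc (r`_0 / q`_0) * normc q`_i.+1))).
  apply: ler_sum => i _; rewrite coef_drop_poly addn1 coefB coefZ.
  by apply: le_trans (le_normcD _ _) _; rewrite normcN normcM.
rewrite big_split /= -mulr_sumr lerD ?shift//.
rewrite normcM normcV.
have -> : poly_norm m q / normc q`_0 * poly_norm m r =
   poly_norm m r / normc q`_0 * poly_norm m q by ring.
apply: ler_pM.
- by rewrite divr_ge0 ?normc_ge0.
- by apply: sumr_ge0 => i _; exact: normc_ge0.
- rewrite ler_wpM2r ?invr_ge0 ?normc_ge0//.
  case: m m0 {pm qm N0 shift ih rm} => // m _; rewrite /poly_norm big_ord_recl lerDl.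
  by apply: sumr_ge0 => i _; exact: normc_ge0.
- exact: shift.
Qed.

Lemma poly_quotient_series p q : q`_0 != 0 -> exists a : nat -> C, exists2 e : R, 0 < e &
  forall h, normc h < e -> q.[h] != 0 /\
  series (fun k => a k * h ^+ k) @ \oo --> p.[h] / q.[h].
Proof.
move=> q0.
pose m := (maxn (size p) (size q)).+1.
have pm : (size p <= m)%N by rewrite /m leqW// leq_maxl.
have qm : (size q <= m)%N by rewrite /m leqW// leq_maxr.
have Q0 : 0 < normc q`_0 by rewrite normc_gt0.
have N0 (r : {poly C}) : 0 <= poly_norm m r by apply: sumr_ge0 => i _; exact: normc_ge0.
set A := 1 + poly_norm m q / normc q`_0.
have A0 : 0 < A by rewrite ltr_pwDl// divr_ge0// ltW.
(* Within this radius |h| A < 1/2, so the remainder after n terms is O(2^-n); the same bound lets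
   the constant term of q dominate the rest of q at h. *)
exists (fun k => (quotient_rest p q k)`_0 / q`_0), (2 * A)^-1.
  by rewrite invr_gt0 mulr_gt0.
move=> h hA.
have hA2 : normc h * A < 2^-1.
  by move: hA; rewrite invfM -ltr_pdivlMr// mulrC.
have A1 : 1 <= A by rewrite lerDl divr_ge0// ltW.
have h1 : normc h <= 1 by have := normc_ge0 h; nra.
have qh : q.[h] != 0.
  apply/eqP => qh0; have := horner_drop1 q h; rewrite qh0 => /esym/eqP.
  rewrite addr_eq0 => /eqP q0E.
  have : normc q`_0 <= normc h * poly_norm m q.
    rewrite q0E normcN normcM ler_wpM2l ?normc_ge0//.
    apply: le_trans (horner_norm (m := m) _ h1) _.
      rewrite size_drop_poly; exact: leq_trans (leq_subr _ _) qm.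
    rewrite /poly_norm [leLHS]big_ord_recr [leRHS]big_ord_recl /=.
    rewrite coef_drop_poly addn1 nth_default//.
    rewrite normc0 addr0; apply: ler_wpDl; first exact: normc_ge0.
    by apply: ler_sum => i _; rewrite coef_drop_poly addn1.
  have AE : poly_norm m q = (A - 1) * normc q`_0.
    by rewrite /A addrAC subrr add0r divfK// lt0r_neq0.
  rewrite AE; have := normc_ge0 h; nra.
split=> //.
have SE n : series (fun k => (quotient_rest p q k)`_0 / q`_0 * h ^+ k) n - p.[h] / q.[h]
    = - (h ^+ n * (quotient_rest p q n).[h] / q.[h]).
  elim: n => [|n ih].
    by rewrite /series /= big_geq// sub0r expr0 mul1r.
  rewrite seriesSr addrAC ih (quotient_restE p n h q0).
  move: (quotient_rest p q n)`_0 (quotient_rest p q n.+1).[h] => a b.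
  rewrite exprSr; field.
  by rewrite q0 qh.
apply/cvgn_normcP => e e0.
pose B := poly_norm m p / normc q.[h].
have B0 : 0 <= B by rewrite divr_ge0// normc_ge0.
have bnd n : normc (series (fun k => (quotient_rest p q k)`_0 / q`_0 * h ^+ k) n - p.[h] / q.[h])
   <= 2^-1 ^+ n * B.
  rewrite SE normcN !normcM normcX normcV /B mulrA ler_wpM2r ?invr_ge0 ?normc_ge0//.
  have h2 : normc (quotient_rest p q n).[h] <= A ^+ n * poly_norm m p.
    apply: le_trans (quotient_rest_norm n pm qm _) => //.
    exact: horner_norm (size_quotient_rest n pm qm) h1.
  apply: (@le_trans _ _ (normc h ^+ n * (A ^+ n * poly_norm m p))).
    by rewrite ler_wpM2l// exprn_ge0// normc_ge0.
  rewrite mulrA -exprMn ler_wpM2r// lerXn2r// ?nnegrE ?invr_ge0//; last exact: ltW.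
  by rewrite mulr_ge0 ?normc_ge0// ltW.
near=> n.
apply: le_lt_trans (bnd n) _.
have : 2^-1 ^+ n * B < e; last by [].
near: n; apply: (cvgr_lt (0 * B)); last by rewrite mul0r.
apply: cvgM; last exact: cvg_cst.
by apply: cvg_expr; rewrite ger0_norm ?invr_ge0// invf_lt1// ltr1n.
Unshelve. all: end_near. Qed.

Lemma rational_series p q c : q.[c] != 0 -> exists a : nat -> C, exists2 e : R, 0 < e &
  forall z, normc (z - c) < e -> q.[z] != 0 /\
  series (fun k => a k * (z - c) ^+ k) @ \oo --> p.[z] / q.[z].
Proof.
move=> qc.
have E (r : {poly C}) z : (r \Po ('X + c%:P)).[z - c] = r.[z].
  by rewrite horner_comp hornerD hornerX hornerC subrK.
have q0 : (q \Po ('X + c%:P))`_0 != 0.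
  by have := E q c; rewrite subrr horner_coef0 => ->.
have [a [e e0 h]] := poly_quotient_series (p \Po ('X + c%:P)) q0.
by exists a, e => // z /h; rewrite !E.
Qed.

Lemma analytic_rational p q c : q.[c] != 0 ->
  analytic_at (fun z => p.[z] / q.[z]) c.
Proof.
move=> /(rational_series p)[a [e e0 h]].
exists a; apply/near_normcP; exists e; first exact: e0.
by move=> z /h[].
Qed.

Lemma rational_neq0_near q c : q.[c] != 0 ->
  exists2 e : R, 0 < e & forall z, normc (z - c) < e -> q.[z] != 0.
Proof.
by move=> /(rational_series 0)[a [e e0 h]]; exists e => // z /h[].
Qed.
End Rational.

Lemma derive_of_limit (R : realType) (F : C R -> C R) (c v : C R) :
  (forall e : R, 0 < e -> exists2 d : R, 0 < d &
   forall h : C R, h != 0 -> normc h < d -> normc ((F (c + h) - F c) / h - v) < e) ->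
  is_derive c 1 F v.
Proof.
move=> H.
have lim0 : (fun h : C R => h^-1 *: ((F \o shift c) (h *: (1 : C R)) - F c)) @ 0^' --> v.
  apply/(@cvgrPdist_lt _ _ _ (0 : C R)^') => e; rewrite ltcE /= => /andP[/eqP e0 e1].
  have [d d0 hd] := H _ e1.
  apply/near_normcP; exists d; first exact: d0.
  move=> h; rewrite subr0 => hlt h0.
  rewrite distrC norm_normc ltcE /= e0 eqxx /= [h *: _](_ : _ = h); last exact: mulr1.
  have := hd h h0 hlt; rewrite [c + h]addrC [_ / h]mulrC.
  by [].
by split; [exact: cvgP lim0|exact: (cvg_lim (@norm_hausdorff _ _) lim0)].
Qed.

(** * The rational function of a minimal null vector *)

Section Construction.
Variables (R : realType) (n : nat) (x w v : 'I_n -> R).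
Notation C := (C R).
Hypothesis x_inj : injective x.
Notation M := (pick_matrix x w v).
Variable u : 'cV[R]_n.
Hypothesis Mu : minimal_null M u.
Hypothesis pM : pos_semidef M.
Hypothesis def0 : forall i, u i 0 = 0 -> defect x w v u i = 0.

Definition nodes_but i : {poly R} :=
  \prod_(l in (support_set u :\ i)%SET) ('X - (x l)%:P).
Definition nodes : {poly R} := \prod_(l in support_set u) ('X - (x l)%:P).
(** The Cauchy sum of u_j a_j / (X - x_j) cleared of denominators by [nodes]. Nodes off the support
    have weight 0, so the degree stays below the size of the support. *)
Definition lagrange (a : 'I_n -> R) : {poly R} :=
  \sum_j (u j 0 * a j) *: nodes_but j.

Lemma nodes_butM j : u j 0 != 0 -> ('X - (x j)%:P) * nodes_but j = nodes.
Proof.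
by move=> uj; rewrite /nodes (big_setD1 j)//= inE.
Qed.

Lemma size_lagrange a : (size (lagrange a) <= #|support_set u|)%N.
Proof.
apply: leq_trans (size_sum _ _ _) _; apply/bigmax_leqP => j _.
have [->|uj] := eqVneq (u j 0) 0; first by rewrite mul0r scale0r size_poly0.
apply: leq_trans (size_scale_leq _ _) _.
rewrite /nodes_but -big_enum size_prod_XsubC -cardE.
by rewrite [leqRHS](cardsD1 j) inE uj.
Qed.

(** Divided by the denominator [lagrange (fun=> 1)] this splits the factor X - x_i off f - w_i,
    which yields value and derivative of f at x_i together. The computation leaves the multiple
    sum_j u_j M_ij of [nodes], which is 0 because M u = 0. *)
Lemma lagrange_sub i :
  lagrange w - w i *: lagrange (fun=> 1) = ('X - (x i)%:P) * lagrange (M i).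
Proof.
have E : ('X - (x i)%:P) * lagrange (M i) =
    \sum_j (u j 0 * M i j) *: nodes + \sum_j (u j 0 * (w j - w i)) *: nodes_but j.
  rewrite /lagrange mulr_sumr -big_split; apply: eq_bigr => j _ /=.
  have [->|uj] := eqVneq (u j 0) 0; first by rewrite !mul0r !scale0r mulr0 addr0.
  have -> : w j - w i = - (M i j * (x i - x j)) by rewrite pick_matrixM// opprB.
  rewrite -(nodes_butM uj) -!mul_polyC.
  rewrite !rmorphM rmorphN rmorphM rmorphB /=; ring.
rewrite E -scaler_suml.
have -> : \sum_j u j 0 * M i j = 0.
  by rewrite -[RHS](null_sum Mu i); apply: eq_bigr => j _; rewrite mulrC.
rewrite scale0r add0r /lagrange scaler_sumr -sumrB; apply: eq_bigr => j _.
by rewrite scalerA -scalerBl; congr (_ *: _); ring.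
Qed.

Lemma horner_lagrange_on a i : u i 0 != 0 ->
  (lagrange a).[x i] = u i 0 * a i * (nodes_but i).[x i].
Proof.
move=> ui; rewrite /lagrange horner_sum (bigD1 i)//= hornerZ big1 ?addr0//.
move=> j ji; rewrite hornerZ /nodes_but (big_setD1 i)/=.
  by rewrite hornerM hornerXsubC subrr mul0r mulr0.
by rewrite !inE ui eq_sym ji.
Qed.

Lemma horner_lagrange_off a i : u i 0 = 0 ->
  (lagrange a).[x i] = nodes.[x i] * \sum_j u j 0 * a j / (x i - x j).
Proof.
move=> ui; rewrite /lagrange horner_sum mulr_sumr; apply: eq_bigr => j _.
have [uj|uj] := eqVneq (u j 0) 0; first by rewrite uj !mul0r scale0r horner0 mulr0.
rewrite -(nodes_butM uj) hornerM hornerXsubC hornerZ; field.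
by rewrite subr_eq0 (inj_eq x_inj); apply: contraNneq uj => <-; rewrite ui.
Qed.

Lemma denominator_neq0 i : (lagrange (fun=> 1)).[x i] != 0.
Proof.
have [ui|ui] := eqVneq (u i 0) 0.
  rewrite horner_lagrange_off// mulf_neq0//.
    rewrite /nodes horner_prod; apply/prodf_neq0 => l; rewrite inE => ul.
    rewrite !hornerE subr_eq0 (inj_eq x_inj).
    by apply: contraNneq ul => <-; rewrite ui.
  have := beta_neq0 x_inj Mu pM ui; rewrite /beta.
  by under eq_bigr do rewrite -[u _ _]mulr1.
rewrite horner_lagrange_on// mulr1 mulf_neq0//.
rewrite /nodes_but horner_prod; apply/prodf_neq0 => l; rewrite !inE => /andP[li _].
by rewrite !hornerE subr_eq0 (inj_eq x_inj) eq_sym.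
Qed.

(** This amounts to f'(x_i) = v_i. On the support it only uses M_ii = v_i; elsewhere it is the
    vanishing of the defect. *)
Lemma horner_quotient i :
  (lagrange (M i)).[x i] = v i * (lagrange (fun=> 1)).[x i].
Proof.
have [ui|ui] := eqVneq (u i 0) 0.
  rewrite !horner_lagrange_off// mulrCA; congr (_ * _).
  have := def0 ui; rewrite /defect => /eqP; rewrite subr_eq0 => /eqP ->.
  by rewrite mulrC /beta; congr (_ * _); apply: eq_bigr => j _; rewrite mulr1.
rewrite !horner_lagrange_on// mxE eqxx; ring.
Qed.

Definition cauchy_sum (a : 'I_n -> R) (z : C) : C :=
  \sum_j (u j 0 * a j)%:C / (z - (x j)%:C).

Lemma Pi_neq (z : C) (r : R) : Pi z -> z - r%:C != 0.
Proof.
case: z => a b; rewrite /Pi /= => b0; rewrite eq_complex /= negb_and orbC.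
by rewrite oppr0 addr0 lt0r_neq0.
Qed.

Lemma eval_lagrange a z : Pi z ->
  real_poly_eval (lagrange a) z = real_poly_eval nodes z * cauchy_sum a z.
Proof.
move=> zP; rewrite /real_poly_eval /lagrange rmorph_sum horner_sum mulr_sumr.
apply: eq_bigr => j _ /=.
have [uj|uj] := eqVneq (u j 0) 0.
  by rewrite uj !mul0r scale0r rmorph0 horner0 mulr0.
rewrite -(nodes_butM uj) [map_poly _ (_ * nodes_but j)]rmorphM hornerM.
rewrite map_polyZ hornerZ rmorphB /= map_polyX map_polyC hornerXsubC /=; field.
exact: Pi_neq.
Qed.

Lemma eval_nodes_neq0 z : Pi z -> real_poly_eval nodes z != 0.
Proof.
move=> zP; rewrite /real_poly_eval /nodes rmorph_prod horner_prod.
apply/prodf_neq0 => l _; rewrite rmorphB /= map_polyX map_polyC !hornerE.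
exact: Pi_neq.
Qed.

Let ry z : 'cV[R]_n := \col_j complex.Re ((u j 0)%:C / (z - (x j)%:C)).
Let iy z : 'cV[R]_n := \col_j complex.Im ((u j 0)%:C / (z - (x j)%:C)).

Lemma cauchy_sum_Im z : Pi z ->
  complex.Im (cauchy_sum w z * conjc (cauchy_sum (fun=> 1) z)) =
  complex.Im z * (bform M (ry z) (ry z) + bform M (iy z) (iy z)).
Proof.
move=> zP.
pose y j : C := (u j 0)%:C / (z - (x j)%:C).
have yE j : (z - (x j)%:C) * y j = (u j 0)%:C.
  by rewrite /y mulrC divfK// Pi_neq.
have yE' j : (conjc z - (x j)%:C) * conjc (y j) = (u j 0)%:C.
  by rewrite -[(x j)%:C in LHS]conjc_real -conjcB -conjcM yE conjc_real.
have cE a : cauchy_sum a z = \sum_j (a j)%:C * y j.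
  apply: eq_bigr => j _; rewrite /y rmorphM /=; ring.
have key : cauchy_sum w z * conjc (cauchy_sum (fun=> 1) z) -
    conjc (cauchy_sum w z) * cauchy_sum (fun=> 1) z
   = (z - conjc z) * \sum_j \sum_k y j * conjc (y k) * (M j k)%:C.
  have Ms j k : M k j = M j k.
    by have /matrixP/(_ j k) := @pick_matrix_sym R n x w v; rewrite mxE.
  have null0 j : \sum_k (M j k)%:C * (u k 0)%:C = 0 :> C.
    rewrite -[RHS](rmorph0 (real_complex R)) -(null_sum Mu j) rmorph_sum.
    by apply: eq_bigr => k _; rewrite rmorphM.
  have -> : cauchy_sum w z * conjc (cauchy_sum (fun=> 1) z) -
    conjc (cauchy_sum w z) * cauchy_sum (fun=> 1) z
     = \sum_j \sum_k ((w j)%:C - (w k)%:C) * (y j * conjc (y k)).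
    rewrite !cE !conjc_sum [X in _ - X]mulrC !mulr_suml -sumrB; apply: eq_bigr => j _.
    rewrite !mulr_sumr -sumrB; apply: eq_bigr => k _.
    by rewrite !conjcM !conjc_real; ring.
  (* Here w_j - w_k = M_jk (x_j - x_k) and x_j - x_k = (z - conj z) - (z - x_j) + (conj z - x_k);
     the last two terms turn y_j and conj y_k into u_j and u_k, and sum to 0 since M u = 0. *)
  transitivity (\sum_j \sum_k ((z - conjc z) * (y j * conjc (y k) * (M j k)%:C)
     - (M k j)%:C * (u j 0)%:C * conjc (y k) + (M j k)%:C * (u k 0)%:C * y j)).
    apply: eq_bigr => j _; apply: eq_bigr => k _.
    rewrite -rmorphB -(@pick_matrixM R n x w v x_inj j k) rmorphM rmorphB /= Ms.
    rewrite -yE -yE'; ring.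
  under eq_bigr do rewrite big_split sumrB /=.
  rewrite big_split sumrB /= [X in _ - X]exchange_big /=.
  rewrite [X in _ - X]big1 ?subr0; last first.
    by move=> k _; rewrite -mulr_suml null0 mul0r.
  rewrite [X in _ + X]big1 ?addr0; last first.
    by move=> k _; rewrite -mulr_suml null0 mul0r.
  by rewrite mulr_sumr; apply: eq_bigr => j _; rewrite mulr_sumr.
have S : \sum_j \sum_k y j * conjc (y k) * (M j k)%:C =
   (bform M (ry z) (ry z) + bform M (iy z) (iy z))%:C.
  have E j k : y j * conjc (y k) * (M j k)%:C =
    (ry z j 0 * ry z k 0 * M j k + iy z j 0 * iy z k 0 * M j k)%:C +
    'i * (iy z j 0 * ry z k 0 * M j k - ry z j 0 * iy z k 0 * M j k)%:C.
    rewrite !mxE -/(y j) -/(y k); case: (y j) (y k) => a b [c d].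
    by apply/eqP; rewrite eq_complex /=; apply/andP; split; apply/eqP; ring.
  under eq_bigr do under eq_bigr do rewrite E.
  under eq_bigr do rewrite big_split /= -mulr_sumr.
  rewrite big_split /= -mulr_sumr.
  have -> : \sum_j \sum_k (iy z j 0 * ry z k 0 * M j k - ry z j 0 * iy z k 0 * M j k)%:C = 0 :> C.
    have B0 : bform M (iy z) (ry z) - bform M (ry z) (iy z) = 0.
      by rewrite bformC ?subrr//; exact: pick_matrix_sym.
    transitivity ((bform M (iy z) (ry z) - bform M (ry z) (iy z))%:C : C).
      2: by rewrite B0.
    rewrite !bform_sumE -sumrB rmorph_sum /=; apply: eq_bigr => j _.
    by rewrite -sumrB rmorph_sum.
  rewrite mulr0 addr0 !bform_sumE -big_split rmorph_sum; apply: eq_bigr => j _ /=.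
  by rewrite -big_split rmorph_sum.
move: key; rewrite S subcJ.
set a := cauchy_sum w z; set b := cauchy_sum (fun=> 1) z.
have -> : conjc a * b = conjc (a * conjc b) by rewrite conjcM conjcK.
rewrite subcJ; move: (bform _ _ _ + _) => B.
have i0 : 'i != 0 :> C by rewrite eq_complex /= eqxx oner_eq0.
rewrite -mulrA [(_)%:C * 'i]mulrC mulrA -[RHS]mulrA.
have -> : 2 * (complex.Im z)%:C * ('i * B%:C) = 2 * 'i * (complex.Im z * B)%:C :> C.
  by rewrite rmorphM /=; ring.
by move=> /mulfI H; apply: (@complexI R); apply: H; rewrite mulf_neq0// pnatr_eq0.
Qed.

(** At a zero, [cauchy_sum_Im] makes the real and imaginary parts of (u_j / (z - x_j))_j null
    vectors, hence multiples of u. So 1 / (z - x_j) is constant on the support, which is then one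
    node, and a single nonzero term cannot vanish. *)
Lemma cauchy_sum_neq0 z : Pi z -> cauchy_sum (fun=> 1) z != 0.
Proof.
move=> zP; apply/eqP => c0.
have := cauchy_sum_Im zP; rewrite c0 conjc0 mulr0 => /esym/eqP.
have z0 : complex.Im z != 0 by rewrite lt0r_neq0.
rewrite mulf_eq0 (negPf z0) /= => h.
have hr : 0 <= bform M (ry z) (ry z) by exact: pM.2.
have hi : 0 <= bform M (iy z) (iy z) by exact: pM.2.
move: h; rewrite paddr_eq0// => /andP[/eqP r0 /eqP i0].
have [u0 _ min] := Mu.
have supp j : u j 0 = 0 -> (u j 0)%:C / (z - (x j)%:C) = 0 by move=> ->; rewrite mul0r.
have [|s sE] := min _ (psd_null pM r0); first by move=> j uj; rewrite mxE supp.
have [|t tE] := min _ (psd_null pM i0); first by move=> j uj; rewrite mxE supp.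
have yE j : u j 0 != 0 -> (z - (x j)%:C)^-1 = (s +i* t).
  move=> uj; have uj' : (u j 0)%:C != 0 :> C by rewrite eq_complex /= eqxx andbT.
  apply: (mulfI uj').
  have := congr1 (fun A : 'cV_n => A j 0) sE; have := congr1 (fun A : 'cV_n => A j 0) tE.
  rewrite !mxE; case: ((u j 0)%:C / _) => a b /= -> ->.
  by apply/eqP; rewrite eq_complex /=; apply/andP; split; apply/eqP; ring.
have [j uj] := cV_neq0 u0.
move/eqP: c0; rewrite /cauchy_sum (bigD1 j)//= big1 ?addr0.
  rewrite mulr1 mulf_eq0 invr_eq0 (negPf (Pi_neq _ zP)) orbF.
  by rewrite eq_complex /= (negPf uj).
move=> k kj; have [->|uk] := eqVneq (u k 0) 0; first by rewrite !mul0r.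
have : (z - (x k)%:C)^-1 = (z - (x j)%:C)^-1 by rewrite !yE.
move=> /invr_inj /addrI /oppr_inj /complexI /x_inj kj'.
by rewrite kj' eqxx in kj.
Qed.

Lemma eval_real (r : {poly R}) (t : R) : real_poly_eval r t%:C = (r.[t])%:C.
Proof. exact: horner_map. Qed.

Lemma minimal_null_solution : exists f d,
  [/\ solution x w v f, real_rational_of_degree f d & (d <= #|support_set u|.-1)%N].
Proof.
set p := lagrange w; set q := lagrange (fun=> 1).
pose f z : C := real_poly_eval p z / real_poly_eval q z.
have qP z : Pi z -> real_poly_eval q z != 0.
  by move=> zP; rewrite eval_lagrange// mulf_neq0 ?eval_nodes_neq0 ?cauchy_sum_neq0.
have q0 : q != 0.
  apply: contraNneq (qP 'i _) => [->|]; last by rewrite /Pi /= ltr01.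
  by rewrite /real_poly_eval rmorph0 horner0.
(* The degree refers to lowest terms, hence the division by the gcd, which can only lower the
   sizes. *)
exists f, (maxn (size (p %/ gcdp p q)).-1 (size (q %/ gcdp p q)).-1); split.
- split.
    move=> z zP; split; first exact: analytic_rational (qP z zP).
    rewrite /f !eval_lagrange// -mulf_div divff ?eval_nodes_neq0// mul1r.
    have c0 := cauchy_sum_neq0 zP; set a := cauchy_sum w z; set b := cauchy_sum _ z in c0 *.
    have -> : a / b = ((normc b ^+ 2)^-1)%:C * (a * conjc b).
      rewrite fmorphV /= -mul_conjc_normc; field.
      by rewrite conjc_eq0 c0.
    have -> : complex.Im (((normc b ^+ 2)^-1)%:C * (a * conjc b)) =
       (normc b ^+ 2)^-1 * complex.Im (a * conjc b).
      by case: (a * conjc b) => ? ? /=; rewrite mul0r addr0.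
    rewrite cauchy_sum_Im// mulr_ge0 ?invr_ge0 ?sqr_ge0// mulr_ge0 ?addr_ge0//.
    + exact: ltW.
    + exact: pM.2.
    + exact: pM.2.
  move=> i; exists f.
  have qi : real_poly_eval q (x i)%:C != 0.
    by rewrite eval_real eq_complex /= eqxx andbT denominator_neq0.
  have sub z : real_poly_eval q z != 0 ->
     f z - (w i)%:C = (z - (x i)%:C) * (real_poly_eval (lagrange (M i)) z / real_poly_eval q z).
    move=> qz; have := congr1 (fun r => real_poly_eval r z) (lagrange_sub i).
    rewrite /real_poly_eval rmorphB rmorphM rmorphB /= map_polyZ map_polyX map_polyC.
    rewrite hornerM hornerXsubC hornerD hornerN hornerZ /= => h.
    rewrite mulrA -h /f /real_poly_eval; field; exact: qz.
  have fi : f (x i)%:C = (w i)%:C.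
    by apply/eqP; rewrite -subr_eq0 sub// subrr mul0r.
  split=> //.
    exists [set z : C | real_poly_eval q z != 0]; split=> //.
    + rewrite openE => z /= /rational_neq0_near[e e0 h].
      by apply/near_normcP; exists e.
    + by move=> z /= qz; exact: analytic_rational.
  apply: derive_of_limit => e e0.
  have /analytic_continuous/cvg_normcP/(_ e e0)/near_normcP[d1 d10 h1] :=
    analytic_rational (map_poly (real_complex R) (lagrange (M i))) qi.
  have [d2 d20 h2] := rational_neq0_near qi.
  exists (Num.min d1 d2); first by rewrite lt_min d10.
  move=> h h0; rewrite lt_min => /andP[hd1 hd2].
  have := h1 ((x i)%:C + h); rewrite [_ + h]addrC addrK => /(_ hd1).
  rewrite -!/(real_poly_eval _ _) !eval_real horner_quotient rmorphM mulfK; last first.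
    by rewrite eq_complex /= eqxx andbT denominator_neq0.
  rewrite [h + _]addrC fi sub; last by apply: h2; rewrite [_ + h]addrC addrK.
  by rewrite [(x i)%:C + h - _]addrAC subrr add0r [h * _]mulrC mulfK.
- exists (p %/ gcdp p q), (q %/ gcdp p q); split=> //.
    by apply: coprimep_div_gcd; rewrite q0 orbT.
  move=> z zP.
  have pE : p = p %/ gcdp p q * gcdp p q by rewrite divpK// dvdp_gcdl.
  have qE : q = q %/ gcdp p q * gcdp p q by rewrite divpK// dvdp_gcdr.
  have evM (a b : {poly R}) : real_poly_eval (a * b) z = real_poly_eval a z * real_poly_eval b z.
    by rewrite /real_poly_eval rmorphM hornerM.
  have := qP z zP; rewrite {1}qE evM mulf_eq0 negb_or => /andP[q1 g1].
  split=> //; rewrite /f.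
  have -> : real_poly_eval p z = real_poly_eval (p %/ gcdp p q) z * real_poly_eval (gcdp p q) z.
    by rewrite -evM -pE.
  have -> : real_poly_eval q z = real_poly_eval (q %/ gcdp p q) z * real_poly_eval (gcdp p q) z.
    by rewrite -evM -qE.
  by rewrite -mulf_div divff// mulr1.
- rewrite geq_max -!subn1; apply/andP; split; apply: leq_sub2r;
    by apply: leq_trans (leq_divp _ _) _; exact: size_lagrange.
Qed.
End Construction.

(** * The three assertions *)

Section Necessity.
Variables (R : realType) (n : nat) (x w v : 'I_n -> R).
Notation C := (C R).
Hypothesis x_inj : injective x.
Notation M := (pick_matrix x w v).

Lemma solution_pos_semidef f : solution x w v f -> pos_semidef M.
Proof.
move=> hf; split; first exact: pick_matrix_sym.
move=> u; rewrite -/(bform _ _ _) bform_sumE.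
exact: (solution_form_ge0 x_inj hf (fun i => u i 0)).
Qed.

Lemma solution_null_vector f (u : 'cV[R]_n) z : solution x w v f ->
  M *m u = 0 -> Pi z ->
  \sum_j (u j 0)%:C * ((f z - (w j)%:C) / (z - (x j)%:C)) = 0.
Proof.
move=> hf Mu zP; apply: (solution_null x_inj hf zP).
by rewrite -bform_sumE bformE Mu big1// => i _; rewrite mxE mulr0.
Qed.

(** Subtracting sum_j u_j M_ij = 0 from the null-vector identity at Z_k = x_i + e_k splits off the
    factor e_k and leaves sum_j u_j (q_k - M_ij) / (Z_k - x_j) = 0. Since q_k tends to v_i, the
    limit says that minus the defect is 0. *)
Lemma solution_defect f (u : 'cV[R]_n) i : solution x w v f ->
  minimal_null M u -> u i 0 = 0 -> defect x w v u i = 0.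
Proof.
move=> hf Mu ui; have [_ Mu0 _] := Mu.
pose e k : C := (harmonic k)%:C * 'i.
pose Z k : C := (x i)%:C + e k.
pose q k : C := (f (Z k) - (w i)%:C) / e k.
have e0 k : e k != 0.
  have hk0 : 0 < harmonic k :> R by exact: harmonic_gt0.
  rewrite mulf_neq0//; first by rewrite eq_complex /= eqxx andbT lt0r_neq0.
  by rewrite eq_complex /= eqxx oner_eq0.
have ZP k : Pi (Z k) := approach_Pi x i k.
have zero k : \sum_j (u j 0)%:C * ((q k - (M i j)%:C) / (Z k - (x j)%:C)) = 0.
  have := solution_null_vector hf Mu0 (ZP k).
  have nul : \sum_j (u j 0 * M i j)%:C = 0 :> C.
    rewrite -rmorph_sum /=.
    have -> : \sum_j u j 0 * M i j = 0.
      by rewrite -[RHS](null_sum Mu i); apply: eq_bigr => j _; rewrite mulrC.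
    by rewrite rmorph0.
  rewrite -[X in X = 0]subr0 -[X in _ - X]nul -sumrB => h.
  apply: (mulfI (e0 k)); rewrite mulr0 -[RHS]h mulr_sumr; apply: eq_bigr => j _.
  have [->|uj] := eqVneq (u j 0) 0; first by rewrite mul0r rmorph0 !mul0r mulr0 subr0.
  have ij : i != j by apply: contraNneq uj => <-; rewrite ui.
  have fE : f (Z k) = (w i)%:C + e k * q k by rewrite /q mulrC divfK// addrC subrK.
  have wE : (w j)%:C = (w i)%:C - (M i j)%:C * ((x i)%:C - (x j)%:C) :> C.
    by rewrite -rmorphB -rmorphM /= pick_matrixM// rmorphB /=; ring.
  have zx : Z k - (x j)%:C != 0 by exact: Pi_neq.
  rewrite fE wE rmorphM /=.
  have -> : e k = Z k - (x i)%:C by rewrite /Z addrAC subrr add0r.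
  by field.
have lim : (fun k => \sum_j (u j 0)%:C * ((q k - (M i j)%:C) / (Z k - (x j)%:C))) @ \oo -->
    ((\sum_j u j 0 * ((v i - M i j) / (x i - x j)))%:C : C).
  rewrite rmorph_sum; apply: cvgn_sum => j.
  have [uj|uj] := eqVneq (u j 0) 0.
    have -> : (fun k => (u j 0)%:C * ((q k - (M i j)%:C) / (Z k - (x j)%:C))) = cst (0 : C).
      by apply/funext => k; rewrite uj mul0r.
    rewrite uj mul0r -[X in _ --> X]/(0 : C); exact: cvg_cst.
  have ij : i != j by apply: contraNneq uj => <-; rewrite ui.
  have xij : (x i)%:C - (x j)%:C != 0 :> C.
    by rewrite -rmorphB fmorph_eq0 subr_eq0 (inj_eq x_inj).
  have E : (u j 0 * ((v i - M i j) / (x i - x j)))%:C =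
     (u j 0)%:C * (((v i)%:C - (M i j)%:C) / ((x i)%:C - (x j)%:C)) :> C.
    by rewrite !rmorphM fmorphV !rmorphB.
  rewrite [X in _ --> X]E.
  have h1 := cvgB (@boundary_quotient R n x w v f hf i) (cvg_cst ((M i j)%:C : C)).
  have h2 := cvgV xij (cvgB (@cvg_approach R n x i) (cvg_cst ((x j)%:C : C))).
  exact: (cvgM (cvg_cst _) (cvgM (h1 _ _) (h2 _ _ _))).
have h : \sum_j u j 0 * ((v i - M i j) / (x i - x j)) = 0.
  apply: (@complexI R); set L : C := (X in X = _).
  apply/eqP; rewrite -[X in _ == X]/(0 : C) -normc_eq0; apply/negPn/negP => L0.
  have Lp : 0 < normc L by rewrite lt_def L0 normc_ge0.
  have [N _ hN] := (cvgn_normcP _ _).1 lim _ Lp.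
  by have := hN N (leqnn N); rewrite /= zero sub0r normcN ltxx.
rewrite /defect /beta mulr_suml -sumrB; apply/eqP.
rewrite -oppr_eq0 -[X in _ == X]h -sumrN; apply/eqP; apply: eq_bigr => j _; ring.
Qed.

Lemma solution_minimally_positive f : solution x w v f ->
  pos_def M \/ minimally_positive M.
Proof.
move=> hf; have pM := solution_pos_semidef hf.
have [pd|npd] := pselect (pos_def M); first by left.
right; have [u0 u00 Mu0] := psd_singular pM npd.
have [u Mu] := exists_minimal_null u00 Mu0.
apply: (defect_minimally_positive x_inj Mu pM) => i.
exact: solution_defect hf Mu.
Qed.

Lemma solution_unique f g u : solution x w v f -> solution x w v g ->
  minimal_null M u -> forall z, Pi z -> g z = f z.
Proof.
move=> hf hg Mu z zP; have pM := solution_pos_semidef hf.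
have c0 := cauchy_sum_neq0 x_inj Mu pM zP.
have [_ Mu0 _] := Mu.
have E h : solution x w v h -> h z * cauchy_sum x u (fun=> 1) z = cauchy_sum x u w z.
  move=> hh; apply/eqP; rewrite -subr_eq0; apply/eqP.
  rewrite -[RHS](solution_null_vector hh Mu0 zP) /cauchy_sum mulr_sumr -sumrB.
  apply: eq_bigr => j _; rewrite mulr1 rmorphM /=; ring.
by apply: (mulIf c0); rewrite !E.
Qed.

Lemma minimally_positive_solution (i : 'I_n) : minimally_positive M ->
  exists f d, [/\ solution x w v f, real_rational_of_degree f d,
    (d <= \rank M)%N & forall g, solution x w v g -> forall z, Pi z -> g z = f z].
Proof.
move=> mM; have pM := mM.1.
have npd : ~ pos_def M by move=> /(pos_def_not_minimally_positive i).
have [u0 u00 Mu0] := psd_singular pM npd.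
have [u Mu] := exists_minimal_null u00 Mu0.
have [|f [d [hf fd dle]]] := minimal_null_solution x_inj Mu pM.
  by move=> j; exact: minimally_positive_defect.
exists f, d; split=> //.
  apply: leq_trans dle _; rewrite -subn1 leq_subLR add1n.
  exact: minimal_null_rank.
by move=> g hg; exact: solution_unique hf hg Mu.
Qed.
End Necessity.

(** * Bordering a positive definite Pick matrix by one node *)

Definition extend (T : Type) n (a : T) (b : 'I_n -> T) (i : 'I_n.+1) : T :=
  if unlift ord0 i is Some j then b j else a.

Lemma extend0 (T : Type) n (a : T) (b : 'I_n -> T) : extend a b ord0 = a.
Proof. by rewrite /extend unlift_none. Qed.

Lemma extendS (T : Type) n (a : T) (b : 'I_n -> T) i :
  extend a b (lift ord0 i) = b i.
Proof. by rewrite /extend liftK. Qed.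

Section Augmentation.
Variables (R : realType) (n : nat) (x w v : 'I_n -> R).
Hypothesis x_inj : injective x.
Notation M := (pick_matrix x w v).
Hypothesis pdM : pos_def M.
Variables (t om : R).
Hypothesis xt : forall j, x j != t.

Let m : 'cV[R]_n := \col_j ((om - w j) / (t - x j)).
Let c : 'cV[R]_n := invmx M *m m.
Let x' := extend t x.
Let w' := extend om w.
(** As c = M^-1 m for the new column m, the entry c^T M c = m^T M^-1 m makes the Schur complement of
    M in M' zero. *)
Let v' := extend (bform M c c) v.
Notation M' := (pick_matrix x' w' v').

Lemma extend_nodes_inj : injective x'.
Proof.
move=> i j; rewrite /x'.
have [i'|] := unliftP ord0 i => ->; have [j'|] := unliftP ord0 j => ->;
  rewrite ?extend0 ?extendS => //.
- by move=> /x_inj ->.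
- by move=> h; have := xt i'; rewrite h eqxx.
- by move=> h; have := xt j'; rewrite -h eqxx.
Qed.

Lemma pick_matrix_unit : M \in unitmx.
Proof. by rewrite -row_free_unit pos_def_row_free. Qed.

Lemma mulmx_extension_coef : M *m c = m.
Proof. by rewrite mulKVmx// pick_matrix_unit. Qed.

(** Completing the square; as M is positive definite, the kernel of M' is the line spanned by (-1,
    c). *)
Lemma bform_extend y : bform M' y y =
  bform M ((\col_j y (lift ord0 j) 0) + y ord0 0 *: c)
          ((\col_j y (lift ord0 j) 0) + y ord0 0 *: c).
Proof.
set z := \col_j _.
rewrite bformDl !bformDr !bformZl !bformZr (bformC c z); last exact: pick_matrix_sym.
have -> : bform M z c = \sum_j y (lift ord0 j) 0 * m j 0.
  by rewrite bformE mulmx_extension_coef; apply: eq_bigr => j _; rewrite mxE.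
rewrite [bform M z z]bform_sumE [LHS]bform_sumE big_ord_recl big_ord_recl.
have -> : M' ord0 ord0 = bform M c c by rewrite mxE eqxx /v' extend0.
have -> : \sum_j y ord0 0 * y (lift ord0 j) 0 * M' ord0 (lift ord0 j) =
   y ord0 0 * \sum_j y (lift ord0 j) 0 * m j 0.
  rewrite mulr_sumr; apply: eq_bigr => j _.
  rewrite -mulrA; congr (_ * (_ * _)).
  by rewrite !mxE /= /x' /w' !extend0 !extendS.
have -> : \sum_i \sum_j y (lift ord0 i) 0 * y j 0 * M' (lift ord0 i) j =
   y ord0 0 * (\sum_j y (lift ord0 j) 0 * m j 0) +
   \sum_i \sum_j z i 0 * z j 0 * M i j.
  rewrite mulr_sumr -big_split; apply: eq_bigr => i _; rewrite big_ord_recl /=.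
  congr (_ + _).
    rewrite !mxE /= /x' /w' !extend0 !extendS.
    rewrite -[om - _]opprB -[t - _]opprB invrN mulrNN; ring.
  apply: eq_bigr => j _; rewrite !mxE (inj_eq (@lift_inj _ ord0)).
  by rewrite /x' /w' /v' !extendS.
ring.
Qed.

Lemma extend_semidef : pos_semidef M'.
Proof.
split; first exact: pick_matrix_sym.
move=> y; rewrite -/(bform _ _ _) bform_extend.
by case: (pos_def_semidef pdM) => _; apply.
Qed.

Let u : 'cV[R]_n.+1 := \col_i extend (-1) (fun j => c j 0) i.

Lemma extend_null : minimal_null M' u.
Proof.
have u00 : u ord0 0 = -1 by rewrite mxE extend0.
have zE (y : 'cV_n.+1) : bform M' y y = 0 -> y = (- y ord0 0) *: u.
  rewrite bform_extend => h.
  have z0 : (\col_j y (lift ord0 j) 0) + y ord0 0 *: c = 0.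
    apply/eqP/negPn/negP => /pdM.2; rewrite -/(bform _ _ _) h ltxx.
    by [].
  apply/matrixP => i k; rewrite (ord1 k) [RHS]mxE.
  have [j|] := unliftP ord0 i => ->; last by rewrite u00; ring.
  rewrite mxE extendS; move/matrixP: z0 => /(_ j 0).
  rewrite mxE [X in X + _]mxE [X in _ + X]mxE [RHS]mxE => /eqP.
  by rewrite addr_eq0 => /eqP ->; ring.
split.
- apply/eqP => /matrixP/(_ ord0 0); rewrite u00 mxE => /eqP.
  by rewrite oppr_eq0 oner_eq0.
- apply: psd_null; first exact: extend_semidef.
  rewrite bform_extend u00.
  have -> : \col_j u (lift ord0 j) 0 + -1 *: c = 0.
    apply/matrixP => i k; rewrite (ord1 k) mxE [X in X + _]mxE [X in _ + X]mxE.
    by rewrite [RHS]mxE /u mxE extendS mulN1r subrr.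
  by rewrite /bform mulmx0 mxE.
- move=> y My _; exists (- y ord0 0); apply: zE.
  by rewrite bformE My big1// => i _; rewrite mxE mulr0.
Qed.

(** When no c_j vanishes the null vector (-1, c) has full support, so no defect remains to be
    checked, and the degree is at most (n + 1) - 1 = n = rank M. *)
Lemma augmented_solution : (forall j, c j 0 != 0) ->
  exists f d, [/\ solution x' w' v' f, real_rational_of_degree f d &
    (d <= \rank M)%N].
Proof.
move=> c0.
have [|f [d [hf fd dle]]] := minimal_null_solution extend_nodes_inj extend_null extend_semidef.
  move=> i; rewrite mxE; have [j|] := unliftP ord0 i => ->.
    by rewrite extendS => /eqP; rewrite (negPf (c0 j)).
  by rewrite extend0 => /eqP; rewrite oppr_eq0 oner_eq0.
exists f, d; split=> //; apply: leq_trans dle _.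
have /eqP -> := pos_def_row_free pdM.
have : (#|support_set u| <= n.+1)%N.
  by apply: leq_trans (max_card _) _; rewrite card_ord.
by case: #|_|.
Qed.

Lemma solution_restrict s f : solution x' w' (extend s v) f -> solution x w v f.
Proof.
move=> [hf h]; split=> // j; have [F] := h (lift ord0 j).
by rewrite /x' /w' !extendS; exists F.
Qed.
End Augmentation.

(** * Choice of the extra node and of its value *)

Section Choice.
Variables (R : realType) (n : nat) (x w v : 'I_n -> R).
Hypothesis x_inj : injective x.
Notation M := (pick_matrix x w v).

Lemma exists_nonroot (p : {poly R}) : p != 0 -> exists t, p.[t] != 0.
Proof.
move=> p0; apply: contrapT => h.
have := @max_poly_roots _ p [seq i%:R | i <- iota 0 (size p)] p0.
rewrite size_map size_iota ltnn => H; suff: false by [].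
apply: H.
  apply/allP => t _; apply/rootP/eqP/negPn/negP => pt; apply: h; exists t.
  exact: pt.
rewrite map_inj_uniq ?iota_uniq// => a b /eqP.
by rewrite eqr_nat => /eqP.
Qed.

Lemma inverse_diag_gt0 j : pos_def M -> 0 < invmx M j j.
Proof.
move=> pdM; have uM : M \in unitmx by rewrite -row_free_unit pos_def_row_free.
set y := invmx M *m delta_mx j 0 : 'cV[R]_n.
have My : M *m y = delta_mx j 0 by rewrite mulKVmx.
have -> : invmx M j j = bform M y y.
  rewrite bformE My (bigD1 j)//= big1 ?addr0.
    by rewrite /y -colE !mxE !eqxx mulr1.
  by move=> k /negPf kj; rewrite [delta_mx _ _ _ _]mxE kj mulr0.
apply: pdM.2; apply/eqP => y0; move: My; rewrite y0 mulmx0 => /matrixP/(_ j 0).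
by rewrite !mxE !eqxx => /esym/eqP; rewrite oner_eq0.
Qed.

(** Each coordinate is a nonzero rational function of t, since its residue at x_j is (M^-1)_jj > 0.
    [P j] is its numerator, and t avoids the roots of all [P j] and the nodes. *)
Lemma exists_node : pos_def M -> exists t, (forall j, x j != t) /\
  forall j, (invmx M *m \col_k (t - x k)^-1) j 0 != 0.
Proof.
move=> pdM.
pose cof k : {poly R} := \prod_(l | l != k) ('X - (x l)%:P).
pose P j : {poly R} := \sum_k invmx M j k *: cof k.
have P0 j : P j != 0.
  apply/eqP => Pj; have := inverse_diag_gt0 j pdM; apply/negP.
  have : (P j).[x j] = 0 by rewrite Pj horner0.
  rewrite horner_sum (bigD1 j)//= big1 ?addr0; last first.
    move=> k kj; rewrite hornerZ /cof (bigD1 j) 1?eq_sym//=.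
    by rewrite hornerM hornerXsubC subrr mul0r mulr0.
  move=> /eqP; rewrite hornerZ mulf_eq0 orbC /cof horner_prod => /orP[|/eqP ->].
    move=> /prodf_eq0[l lj]; rewrite hornerXsubC subr_eq0 (inj_eq x_inj).
    by rewrite eq_sym (negPf lj).
  by rewrite ltxx.
have [|t] := @exists_nonroot ((\prod_j P j) * \prod_l ('X - (x l)%:P)).
  rewrite mulf_neq0//; first exact/prodf_neq0.
  by apply/prodf_neq0 => l _; rewrite polyXsubC_eq0.
rewrite hornerM mulf_eq0 negb_or !horner_prod => /andP[/prodf_neq0 Pt /prodf_neq0 xt].
have tx j : t - x j != 0 by have := xt j isT; rewrite hornerXsubC.
exists t; split=> j; first by rewrite eq_sym -subr_eq0.
have := Pt j isT; apply: contraNneq => h.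
apply/eqP; rewrite -[RHS](mulr0 (\prod_l (t - x l))) -[X in _ * X]h.
rewrite horner_sum mxE mulr_sumr; apply: eq_bigr => k _.
rewrite hornerZ /cof horner_prod mxE [in RHS](bigD1 k)//=.
under eq_bigr do rewrite hornerXsubC.
by field.
Qed.

(** The coordinates are affine in om, with slopes nonzero by the choice of t; [Q] is the product of
    these affine functions. *)
Lemma exists_values t : (forall j, (invmx M *m \col_k (t - x k)^-1) j 0 != 0) ->
  exists om1 om2, om1 != om2 /\ forall om, om = om1 \/ om = om2 ->
  forall j, (invmx M *m \col_k ((om - w k) / (t - x k))) j 0 != 0.
Proof.
move=> A0.
pose Q : {poly R} := \prod_j ((invmx M *m \col_k (t - x k)^-1) j 0 *: 'X -
   ((invmx M *m \col_k (w k / (t - x k))) j 0)%:P).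
have Q0 : Q != 0.
  apply/prodf_neq0 => j _; apply/eqP => /(congr1 (fun p : {poly R} => p`_1)).
  rewrite coefB coefZ coefX coefC /= mulr1 subr0 coef0.
  by apply/eqP.
have QE om : Q.[om] != 0 -> forall j, (invmx M *m \col_k ((om - w k) / (t - x k))) j 0 != 0.
  rewrite horner_prod => /prodf_neq0 h j; have := h j isT.
  rewrite hornerD hornerN hornerZ hornerX hornerC.
  rewrite (_ : _ - _ = (invmx M *m \col_k ((om - w k) / (t - x k))) j 0)//.
  rewrite !mxE mulr_suml -sumrB; apply: eq_bigr => k _.
  by rewrite !mxE; ring.
have [om1 h1] := exists_nonroot Q0.
have [|om2] := @exists_nonroot (Q * ('X - om1%:P)).
  by rewrite mulf_neq0// polyXsubC_eq0.
rewrite hornerM hornerXsubC mulf_eq0 negb_or subr_eq0 => /andP[h2 h12].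
exists om1, om2; split; first by rewrite eq_sym.
by move=> om [] ->; exact: QE.
Qed.

Lemma pos_def_solutions (i : 'I_n) : pos_def M ->
  exists f g d, [/\ solution x w v f, solution x w v g, real_rational_of_degree f d,
   (d <= \rank M)%N & ~ (forall z, Pi z -> g z = f z)].
Proof.
move=> pdM; have [t [xt At]] := exists_node pdM.
have [om1 [om2 [om12 hom]]] := exists_values At.
have [|f [d [hf fd dle]]] := augmented_solution x_inj pdM xt (om := om1).
  by move=> j; apply: hom; left.
have [|g [e [hg _ _]]] := augmented_solution x_inj pdM xt (om := om2).
  by move=> j; apply: hom; right.
exists f, g, d; split=> //.
- exact: solution_restrict hf.
- exact: solution_restrict hg.
(* The two solutions have boundary values om1 and om2 at t; equality on Pi would make their vertical
   limits there agree. *)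
move=> gf; move/eqP: om12; apply; apply: (@complexI R).
have /cvgn_normcP l1 := @cvg_solution R n.+1 _ _ _ f hf ord0.
have /cvgn_normcP l2 := @cvg_solution R n.+1 _ _ _ g hg ord0.
rewrite !extend0 in l1 l2.
apply/eqP; rewrite -subr_eq0 -normc_eq0; apply/negPn/negP => d0.
have dp : 0 < normc (om1%:C - om2%:C) / 2 by rewrite divr_gt0// lt_def d0 normc_ge0.
have [N1 _ h1] := l1 _ dp; have [N2 _ h2] := l2 _ dp.
have := h1 (maxn N1 N2) (leq_maxl _ _); have := h2 (maxn N1 N2) (leq_maxr _ _).
rewrite /= gf; last exact: (@approach_Pi R 1 (fun=> t) ord0 _).
move: (f _) => a; rewrite -(normcN (a - om1%:C)) => ha hb.
have := le_normcD (a - om2%:C) (- (a - om1%:C)).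
have -> : a - om2%:C + - (a - om1%:C) = om1%:C - om2%:C by ring.
by rewrite leNgt => /negP; apply; rewrite [ltRHS]splitr ltrD.
Qed.
End Choice.

Theorem theorem2p1 (R : realType) (n : nat) (n_ge1 : (1 <= n)%N)
    (x w v : 'I_n -> R) (x_distinct : injective x)
    (v_ge0 : forall j : 'I_n, 0 <= v j) :
  let M := pick_matrix x w v in
  [/\ solvable_problem x w v <-> pos_def M \/ minimally_positive M,
      solvable_problem x w v ->
        exists (f : C R -> C R) (d : nat),
          [/\ solution x w v f, real_rational_of_degree f d
            & (d <= \rank M)%N]
    & determinate x w v <-> minimally_positive M].
Proof.
move=> M; pose i0 : 'I_n := Ordinal n_ge1.
have exist : pos_def M \/ minimally_positive M ->
    exists f d, [/\ solution x w v f, real_rational_of_degree f d & (d <= \rank M)%N].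
  case=> [pd|mp].
    have [f [_ [d [hf _ fd dle _]]]] := pos_def_solutions x_distinct i0 pd.
    by exists f, d.
  have [f [d [hf fd dle _]]] := minimally_positive_solution x_distinct i0 mp.
  by exists f, d.
have nec : solvable_problem x w v -> pos_def M \/ minimally_positive M.
  by move=> [f hf]; exact: solution_minimally_positive hf.
split.
- split; first exact: nec.
  by move=> /exist[f [d [hf _ _]]]; exists f.
- by move=> /nec /exist.
split.
  move=> [f hf funiq]; have [pd|//] := nec (ex_intro _ f hf).
  have [g1 [g2 [d [h1 h2 _ _ g12]]]] := pos_def_solutions x_distinct i0 pd.
  by case: g12 => z zP; rewrite (funiq g1 h1 z zP) (funiq g2 h2 z zP).
move=> mp; have [f [d [hf _ _ fu]]] := minimally_positive_solution x_distinct i0 mp.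
by exists f.
Qed.
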